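(* Let $G$ be a $d$-regular graph on $n$ vertices with $d\in[3,\mathcal{O}(\log n)]$ and girth at least $10l(\log\log n)^2$, where $l$ is a positive integer with $l=\omega(1)$ and $l=o(\log_d n)$. Let $r_G=\lceil 2\log_{d-1}\log n\rceil$, $\gamma'_G=\sqrt{\log_d n/r_G}$ and $\gamma_G=\sqrt{\log_d n}$. Let $m^*$ denote the maximum load after the algorithm $\mathcal{A}'(G,l)$ has allocated $n$ balls. Then with high probability: (I) if $\omega(1)\le l\le 4\gamma'_G$, then $m^*=\mathcal{O}\!\left(\frac{\log_d n\cdot\log\log n}{r_G\, l^2}\right)$; (II) if $l\ge 4\gamma'_G$, then $m^*=\mathcal{O}\!\left(\frac{\log\log n}{\log(l/\gamma_G)}\right)$.
   Context: The $n$ vertices of $G$ are bins; the load of a vertex is the number of balls on it. A non-backtracking random walk (NBRW) of length $L$ from a vertex is a walk of $L$ steps in which at each step the walker moves to a uniformly random neighbour of its current vertex, never traversing the same edge twice in a row. Algorithm $\mathcal{A}'(G,l)$: for $t=1,\dots,n$, ball $t$ picks a vertex of $G$ uniformly at random and performs an NBRW of length $l\cdot r_G$ from it, visiting $(u_0,u_1,\dots,u_{l r_G})$; the potential choices are $\{u_{j r_G}: 0\le j\le l\}$, and the ball is placed on a potential choice of minimum current load, ties broken uniformly at random. Asymptotics are as $n\to\infty$; ''with high probability'' means with probability $1-n^{-c}$ for a constant $c>0$.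
   Formalization: In (II), when 4γ'_G ≤ l ≤ γ_G the quantity log(l/γ_G) is zero or negative, so the stated bound is undefined or false (m* ≥ 1); there the bound proved is O(log log n), while for l > γ_G it is exactly as stated. *)

(* Defs.v *)
From HB Require Import structures.
From mathcomp Require Import all_boot all_order all_algebra.
From mathcomp Require Import all_classical all_reals all_analysis.
Set Implicit Arguments.
Unset Strict Implicit.
Unset Printing Implicit Defensive.
Import Order.TTheory GRing.Theory Num.Theory.
Import numFieldNormedType.Exports.
Local Open Scope classical_set_scope.
Local Open Scope ring_scope.

Definition simple_graph (V : finType) (e : rel V) : Prop :=
  symmetric e /\ irreflexive e.

Definition regular (V : finType) (e : rel V) (d : nat) : Prop :=
  forall x, #|[set y | e x y]%SET| = d.

Definition graph_cycle (V : finType) (e : rel V) (c : seq V) : Prop :=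
  (3 <= size c)%N /\ ucycle e c.

(* +oo for an acyclic graph *)
Definition girth (R : realType) (V : finType) (e : rel V) : \bar R :=
  ereal_inf [set ((size c)%:R)%:E | c in [set c | graph_cycle e c]].

Definition logb (R : realType) (b x : R) : R := ln x / ln b.

Definition loglog (R : realType) (n : nat) : R := ln (ln n%:R).

(* The argument of the ceiling is positive as soon as n >= 3, and there
   [absz] only converts from int to nat. *)
Definition rG (R : realType) (n d : nat) : nat :=
  `|Num.ceil (2 * logb (d%:R - 1) (ln n%:R) : R)|%N.

Definition gammaG (R : realType) (n d : nat) : R :=
  Num.sqrt (logb d%:R n%:R).

Definition gammaG' (R : realType) (n d : nat) : R :=
  Num.sqrt (logb d%:R n%:R / (rG R n d)%:R).

Section Allocation.
Variables (R : realType) (V : finType) (e : rel V).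

Definition unif (A : {set V}) (y : V) : R := (y \in A)%:R / #|A|%:R.

(* In a simple graph, not traversing the same edge twice in a row means not
   returning to the previous vertex; there is none ([None]) at the first step. *)
Definition nb_moves (prev : option V) (cur : V) : {set V} :=
  [set y | e cur y & Some y != prev]%SET.

Fixpoint nb_steps_prob (prev : option V) (cur : V) (s : seq V) : R :=
  if s is y :: s' then
    unif (nb_moves prev cur) y * nb_steps_prob (Some cur) y s'
  else 1.

(* Law of (u_0, ..., u_L): uniform start, then a non-backtracking walk. *)
Definition nbrw_law (L : nat) (u : L.+1.-tuple V) : R :=
  unif [set: V]%SET (thead u) * nb_steps_prob None (thead u) (behead u).

Variables (r l : nat).

Definition walk : finType := (l * r).+1.-tuple V.

Definition choices (u : walk) : {set V} :=
  [set tnth u (inord (j * r)) | j : 'I_l.+1]%SET.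

(* A run records, for each of the #|V| balls, the walk it performs and the
   vertex on which it is placed; ball t of the text is index t - 1. *)
Definition run : finType := {ffun 'I_#|V| -> walk * V}.

Definition load (om : run) (t : nat) (v : V) : nat :=
  #|[set s : 'I_#|V| | (s < t)%N & (om s).2 == v]%SET|.

Definition least_loaded (ld : V -> nat) (S : {set V}) : {set V} :=
  [set v in S | [forall u in S, (ld v <= ld u)%N]]%SET.

(* Chain rule: given the past, ball t performs a fresh walk and is then placed
   uniformly among its least loaded choices, for the loads just before t. *)
Definition run_law (om : run) : R :=
  \prod_(t < #|V|)
    (nbrw_law (om t).1 *
     unif (least_loaded (load om t) (choices (om t).1)) (om t).2).

Definition Pr_run (A : pred run) : R := \sum_(om | A om) run_law om.

Definition max_load (om : run) : nat := \max_v load om #|V| v.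

(* Pr (m* <= b) *)
Definition Pr_max_load_le (b : R) : R :=
  Pr_run (fun om => (max_load om)%:R <= b).

End Allocation.

(* The maximum load of A'(G_k, l_k) is O(f k), with probability at least
   1 - n_k^(-c), along a sequence of graphs G_k on n_k = #|V k| vertices. *)
Definition whp_max_load_bigO (R : realType) (V : nat -> finType)
    (e : forall k, rel (V k)) (d l : nat -> nat) (f : nat -> R) : Prop :=
  exists C c : R, [/\ 0 < C, 0 < c &
    \forall k \near \oo,
      1 - #|V k|%:R `^ (- c) <=
        Pr_max_load_le (e k) (rG R #|V k| (d k)) (l k) (C * f k)].

Definition bound_I (R : realType) (n d l : nat) : R :=
  (logb d%:R n%:R * loglog R n) / ((rG R n d)%:R * l%:R ^+ 2).

(* For 4 gamma'_G <= l <= gamma_G the logarithm log (l / gamma_G) is not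
   positive and the formula loglog n / log (l / gamma_G) is not an upper bound
   of anything; there the bound is read as loglog n, the order of magnitude of
   [bound_I] at the threshold l = 4 gamma'_G. *)
Definition bound_II (R : realType) (n d l : nat) : R :=
  if gammaG R n d < l%:R then loglog R n / ln (l%:R / gammaG R n d)
  else loglog R n.

(* Main.v *)
Require Import Defs.
From HB Require Import structures.
From mathcomp Require Import all_boot all_order all_algebra.
From mathcomp Require Import all_classical all_reals all_analysis.
From mathcomp Require Import ring lra zify.
Set Implicit Arguments.
Unset Strict Implicit.
Unset Printing Implicit Defensive.
Import Order.TTheory GRing.Theory Num.Theory.
Import numFieldNormedType.Exports.
Local Open Scope classical_set_scope.
Local Open Scope ring_scope.

(** Call a set of bins sparse if, from every state, the non-backtracking walk
    hits it after [r] steps with probability at most 1/2. A walk all of whose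
    choices lie in a sparse set has probability exponentially small in [l], even
    when conditioned to visit a given bin: the walk law is reversible, so at least
    half of the choices can be taken to come after the visit. Hence, while the
    bins of load at least [i] are sparse, a ball falls on a given such bin with
    probability at most [eps / n], [eps = l.+1 * (3/4) ^ (l/2)], and, by the random
    tie-breaking, on a given bin of load [i - 1] with probability at most [32 / n].

    Cut the [n] balls into [M] phases, [M] a large constant. By an exponential
    Markov inequality, all through phase [i] the bins of load at least [i] remain
    sparse: the [r]-spheres have at least [(ln n) ^ 2] vertices, since the girth
    exceeds [2 r], and only few of their vertices reach load [i] in one phase.
    Hence bins of load at least [M] always get a ball with probability at most
    [eps / n].

    If a bin reaches load more than [M + h], then all [l + 1] choices of the walk
    of its last ball have load at least [M + h], so [h (l + 1)] balls fell on them
    above level [M], which has probability about [eps ^ (h (l + 1))]. A union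
    bound over the at most [n d ^ (l r)] walks succeeds as soon as [l ^ 2 h] is a
    large multiple of [ln n] and [l h] one of [ln (ln n)]; both bounds of the
    theorem meet this up to a constant factor. *)

(** * Sums over tuples and adapted processes *)

Section TupleSums.
Variables (R : realType) (T : finType).

Lemma sum_tuple0 (F : seq T -> R) : \sum_(u : 0.-tuple T) F u = F [::].
Proof.
rewrite (big_pred1 [tuple]) // => u; exact/esym/eqP/tuple0.
Qed.

Lemma sum_tuple_rcons n (F : seq T -> R) :
  \sum_(u : n.+1.-tuple T) F u = \sum_(u : n.-tuple T) \sum_(x : T) F (rcons u x).
Proof.
rewrite pair_big /=.
rewrite (reindex (fun p : n.-tuple T * T => [tuple of rcons p.1 p.2])) //=.
exists (fun u : n.+1.-tuple T => ([tuple of belast (thead u) (behead u)],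
   last (thead u) (behead u))).
  move=> [u x] _ /=; case: u => [[|a u] Hu]; congr pair.
  - exact/val_inj.
  - exact/val_inj/(belast_rcons a u x).
  - by rewrite /= /thead (tnth_nth x) /= last_rcons.
move=> u _; apply: val_inj => /=; case/tupleP: u => a u /=.
by rewrite theadE -lastI.
Qed.

Lemma sum_tuple_cat m n (F : seq T -> R) :
  \sum_(u : (m + n).-tuple T) F u =
  \sum_(u : m.-tuple T) \sum_(w : n.-tuple T) F (u ++ w).
Proof.
elim: n F => [|n IH] F.
  rewrite addn0; apply: eq_bigr => u _; rewrite (sum_tuple0 (fun w => F (u ++ w))).
  by rewrite cats0.
rewrite addnS sum_tuple_rcons (IH (fun s => \sum_x F (rcons s x))); apply: eq_bigr => u _.
rewrite (sum_tuple_rcons n (fun w => F (u ++ w))); apply: eq_bigr => w _.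
by apply: eq_bigr => x _; rewrite rcons_cat.
Qed.

Lemma sum_tuple_cons n (F : seq T -> R) :
  \sum_(u : n.+1.-tuple T) F u = \sum_(x : T) \sum_(u : n.-tuple T) F (x :: u).
Proof.
have -> : \sum_(u : n.+1.-tuple T) F u = \sum_(u : (1 + n).-tuple T) F u by [].
rewrite sum_tuple_cat.
rewrite (sum_tuple_rcons 0 (fun u => \sum_(w : n.-tuple T) F (u ++ w))).
by rewrite (sum_tuple0 (fun u => \sum_x \sum_(w : n.-tuple T) F (rcons u x ++ w))).
Qed.

Lemma sum_tuple_rev n (F : seq T -> R) :
  \sum_(u : n.-tuple T) F u = \sum_(u : n.-tuple T) F (rev u).
Proof.
rewrite (reindex (fun u : n.-tuple T => [tuple of rev u])) //=.
by exists (fun u : n.-tuple T => [tuple of rev u]) => u _; apply: val_inj;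
   rewrite /= revK.
Qed.

(** Runs are finite functions, whereas conditioning on the past works with prefixes of sequences;
    this passes from one to the other. *)
Lemma sum_ffun_tuple n (F : seq T -> R) :
  \sum_(f : {ffun 'I_n -> T}) F [seq f i | i <- enum 'I_n] =
  \sum_(u : n.-tuple T) F u.
Proof.
rewrite (reindex (fun u : n.-tuple T => [ffun i => tnth u i])) /=.
  apply: eq_bigr => u _; congr F.
  rewrite -[RHS]map_tnth_enum; apply: eq_map => i; exact: ffunE.
exists (fun f : {ffun 'I_n -> T} => [tuple f i | i < n]).
  by move=> u _; apply: eq_from_tnth => i; rewrite tnth_mktuple ffunE.
by move=> f _; apply/ffunP => i; rewrite ffunE tnth_mktuple.
Qed.

End TupleSums.

(** * Adapted processes and an exponential Markov inequality *)

Section AdaptedProcess.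
Variables (R : realType) (T : finType) (n : nat).

Definition hist (om : {ffun 'I_n -> T}) : seq T := [seq om i | i <- enum 'I_n].

Lemma size_hist om : size (hist om) = n.
Proof. by rewrite size_map size_enum_ord. Qed.

Lemma nth_hist x0 om (t : 'I_n) : nth x0 (hist om) t = om t.
Proof. by rewrite (nth_map t) ?size_enum_ord // nth_ord_enum. Qed.

Definition chain (F : seq T -> T -> R) m (x0 : T) (s : seq T) : R :=
  \prod_(t < m) F (take t s) (nth x0 s t).

Lemma chain_rcons F m x0 s x : size s = m ->
  chain F m.+1 x0 (rcons s x) = chain F m x0 s * F s x.
Proof.
move=> sz; rewrite /chain big_ord_recr /=; congr (_ * _).
  by apply: eq_bigr => i _; rewrite nth_rcons sz ltn_ord -cats1 takel_cat // sz ltnW.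
by rewrite nth_rcons sz ltnn eqxx -cats1 take_size_cat.
Qed.

(** The last entry is summed out first: given its history it contributes at most [c m]. That [c m]
    is nonnegative is itself read off from the bound, at some history of length [m]. *)
Lemma sum_chain_le F c x0 m : (forall s x, 0 <= F s x) ->
  (forall s, (size s < m)%N -> \sum_x F s x <= c (size s)) ->
  \sum_(u : m.-tuple T) chain F m x0 u <= \prod_(t < m) c t.
Proof.
move=> F0; elim: m => [|m IH] Fc.
  by rewrite (sum_tuple0 (chain F 0 x0)) /chain !big_ord0.
rewrite (sum_tuple_rcons m (chain F m.+1 x0)) big_ord_recr /=.
have c0 (s : m.-tuple T) : 0 <= c m.
  rewrite -(size_tuple s); apply: le_trans (Fc s _); last by rewrite size_tuple.
  exact: sumr_ge0.
apply: (@le_trans _ _ (\sum_(u : m.-tuple T) chain F m x0 u * c m)).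
  apply: ler_sum => u _.
  under eq_bigr => x _ do rewrite chain_rcons ?size_tuple //.
  rewrite -big_distrr /=; apply: ler_wpM2l; first exact: prodr_ge0.
  by have := Fc u; rewrite size_tuple; apply.
rewrite -big_distrl /=; apply: ler_wpM2r.
  by have /c0 : m.-tuple T := nseq_tuple m x0.
by apply: IH => s ss; apply: Fc; rewrite ltnW.
Qed.

Lemma sum_chain1 F x0 m : (forall s, \sum_x F s x = 1) ->
  \sum_(u : m.-tuple T) chain F m x0 u = 1.
Proof.
move=> F1; elim: m => [|m IH].
  by rewrite (sum_tuple0 (chain F 0 x0)) /chain !big_ord0.
rewrite (sum_tuple_rcons m (chain F m.+1 x0)) -[RHS]IH; apply: eq_bigr => u _.
under eq_bigr => x _ do rewrite chain_rcons ?size_tuple //.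
by rewrite -big_distrr /= F1 mulr1.
Qed.

Definition run_kernel (K : seq T -> T -> R) (om : {ffun 'I_n -> T}) : R :=
  \prod_(t < n) K (take t (hist om)) (om t).

Definition hits (X : seq T -> T -> bool) (om : {ffun 'I_n -> T}) : nat :=
  #|[set t : 'I_n | X (take t (hist om)) (om t)]%SET|.

Lemma run_kernel_chain K x0 om : run_kernel K om = chain K n x0 (hist om).
Proof. by apply: eq_bigr => t _; rewrite nth_hist. Qed.

Lemma sum_run_kernel1 K (x0 : T) : (forall s, \sum_x K s x = 1) ->
  \sum_(om : {ffun 'I_n -> T}) run_kernel K om = 1.
Proof.
move=> K1; rewrite -[RHS](sum_chain1 x0 n K1) -sum_ffun_tuple.
by apply: eq_bigr => om _; rewrite (run_kernel_chain K x0).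
Qed.

(** On the event, [z ^+ hits] is at least [z ^+ k]. Weighting each hit by [z] tilts the kernel,
    whose mass given the past becomes [1 + (z - 1) q <= 1 + z p <= expR (z p)], where [q] is the
    conditional probability of a hit. *)
Lemma hits_tail (K : seq T -> T -> R) (X : seq T -> T -> bool) (p : nat -> R)
    (z : R) (k : nat) (x0 : T) :
  1 <= z -> (forall s x, 0 <= K s x) -> (forall s, \sum_x K s x = 1) ->
  (forall s, (size s < n)%N -> \sum_(x | X s x) K s x <= p (size s)) ->
  \sum_(om : {ffun 'I_n -> T} | (k <= hits X om)%N) run_kernel K om <=
    z ^- k * expR (z * \sum_(t < n) p t).
Proof.
move=> z1 K0 K1 Kp.
have z0 : 0 < z by exact: lt_le_trans z1.
pose F s x := K s x * z ^+ (X s x).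
have zhits om : \prod_(t < n) z ^+ (X (take t (hist om)) (om t)) = z ^+ hits X om.
  rewrite -expr_sum; congr (_ ^+ _); rewrite /hits -sum1_card.
  by rewrite (big_mkcond (fun i => i \in _)) /=; apply: eq_bigr => i _; rewrite inE; case: (X _ _).
apply: (@le_trans _ _ (\sum_(om : {ffun 'I_n -> T}) z ^- k * run_kernel F om)).
  rewrite [leLHS]big_mkcond; apply: ler_sum => om _.
  have K0' : 0 <= run_kernel K om by apply: prodr_ge0.
  have -> : run_kernel F om = run_kernel K om * z ^+ hits X om.
    by rewrite -zhits -big_split.
  case: ifP => [kh|_]; last first.
    by rewrite !mulr_ge0 ?invr_ge0 ?exprn_ge0 // ltW.
  rewrite mulrCA ler_peMr // mulrC.
  rewrite ler_pdivlMr ?exprn_gt0 // mul1r; exact: ler_weXn2l.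
rewrite -big_distrr /=; apply: ler_wpM2l; first by rewrite invr_ge0 exprn_ge0 // ltW.
rewrite big_distrr /= expR_sum.
under eq_bigr => om _ do rewrite (run_kernel_chain F x0).
rewrite (sum_ffun_tuple n (chain F n x0)).
apply: (@sum_chain_le F (fun t => expR (z * p t))) => [s x|s ss].
  by rewrite mulr_ge0 // exprn_ge0 // ltW.
apply: le_trans (expR_ge1Dx _).
rewrite (bigID (X s)) /= -(K1 s) [in leRHS](bigID (X s)) /=.
have -> : \sum_(x | X s x) F s x = z * \sum_(x | X s x) K s x.
  by rewrite big_distrr /=; apply: eq_bigr => x Xx; rewrite /F Xx expr1 mulrC.
have -> : \sum_(x | ~~ X s x) F s x = \sum_(x | ~~ X s x) K s x.
  by apply: eq_bigr => x /negPf Xx; rewrite /F Xx expr0 mulr1.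
have A0 : 0 <= \sum_(x | X s x) K s x by apply: sumr_ge0.
have zp : z * \sum_(x | X s x) K s x <= z * p (size s).
  by apply: ler_wpM2l; [exact: ltW|exact: Kp].
by rewrite addrC; apply: lerD zp; rewrite lerDr.
Qed.

End AdaptedProcess.

(** * Non-backtracking walks *)

Section NonBacktracking.
Variables (V : finType) (e : rel V).
Hypothesis simple_e : simple_graph e.

Fixpoint nb_walk (u : seq V) : bool :=
  if u is x :: t then
    if t is y :: s then
      [&& e x y, (if s is z :: _ then x != z else true) & nb_walk t]
    else true
  else true.

Lemma nb_walk_cons2 x y s : nb_walk (x :: y :: s) =
  [&& e x y, (if s is z :: _ then x != z else true) & nb_walk (y :: s)].
Proof. by []. Qed.

Lemma nb_walkP x0 u : reflect
  ((forall i, (i.+1 < size u)%N -> e (nth x0 u i) (nth x0 u i.+1)) /\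
   (forall i, (i.+2 < size u)%N -> nth x0 u i != nth x0 u i.+2))
  (nb_walk u).
Proof.
apply: (iffP idP).
  elim: u => [|x [|y s] IH]; try by [].
  rewrite nb_walk_cons2 => /and3P[exy xz /IH [H1 H2]]; split.
    by case=> [|i] // Hi; exact: H1.
  case=> [|i] Hi; last exact: H2.
  by case: s xz Hi {IH H1 H2}.
elim: u => [|x [|y s] IH]; try by [].
rewrite nb_walk_cons2 => -[H1 H2]; apply/and3P; split.
- exact: (H1 0).
- by case: s {IH H1} H2 => // z s H2; exact: (H2 0).
- by apply: IH; split=> i Hi; [exact: (H1 i.+1)|exact: (H2 i.+1)].
Qed.

Lemma nb_walk_rev u : nb_walk (rev u) = nb_walk u.
Proof.
have W (v : seq V) : nb_walk v -> nb_walk (rev v).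
  case: v => // x0 v0; set v := x0 :: v0 => /(nb_walkP x0)[H1 H2].
  apply/(nb_walkP x0); rewrite size_rev; split=> i Hi.
    rewrite !nth_rev ?(ltnW Hi) //; have := H1 (size v - i.+2)%N.
    rewrite (_ : (size v - i.+2).+1 = size v - i.+1)%N; last by rewrite subnSK.
    by rewrite simple_e.1; apply; rewrite ltn_subrL.
  rewrite !nth_rev; try lia; have := H2 (size v - i.+3)%N.
  rewrite (_ : (size v - i.+3).+2 = size v - i.+1)%N; last first.
    by rewrite subnSK // subnSK // ltnW.
  by rewrite eq_sym; apply; rewrite ltn_subrL.
by apply/idP/idP => [/W|]; [rewrite revK|exact: W].
Qed.

Lemma nb_walk_infix u a b : nb_walk u -> nb_walk (take a (drop b u)).
Proof.
case: u => // x0 u0; set u := x0 :: u0 => /(nb_walkP x0)[H1 H2].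
apply/(nb_walkP x0); rewrite size_take_min size_drop.
have sz i : (i < minn a (size u - b) -> (i < a) && (b + i < size u))%N.
  by rewrite leq_min ltn_subRL.
split=> i Hi.
  have /andP[ia ib] := sz _ Hi.
  by rewrite !nth_take ?(ltnW ia) // !nth_drop addnS H1 // -addnS.
have /andP[ia ib] := sz _ Hi.
rewrite !nth_take; try lia.
rewrite !nth_drop !addnS H2 //; lia.
Qed.

(* If the first entry recurs in a duplicate-free tail, the walk up to there is a
   cycle: its length is not 1 (no loops) nor 2 (no backtracking). *)
Lemma nb_walk_uniq (g : nat) (u : seq V) :
  (forall c, graph_cycle e c -> (g < size c)%N) ->
  nb_walk u -> (size u <= g.+1)%N -> uniq u.
Proof.
move=> girth; have [m] := ubnP (size u); elim: m u => // m IH u szu nbu szg.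
case: u szu nbu szg => // x s szu nbu szg.
have us : uniq s.
  apply: IH; first exact: szu.
    by have := nb_walk_infix (size s) 1 nbu; rewrite /= drop0 take_size.
  exact: ltnW.
rewrite /= us andbT; apply/negP => xs.
case/splitPr: xs szu nbu szg us => p1 p2 szu nbu szg us.
have nbc : nb_walk (x :: rcons p1 x).
  have := nb_walk_infix (size p1).+2 0 nbu.
  by rewrite drop0 /= -cat_rcons take_size_cat // size_rcons.
have uc : uniq (x :: p1).
  move: us; rewrite cat_uniq /= => /and3P[-> /norP[xp1 _] _].
  by rewrite andbT.
have cyc : cycle e (x :: p1).
  rewrite /=; apply/(pathP x) => i; rewrite size_rcons => Hi.
  have [+ _] := nb_walkP x _ nbc => /(_ i).
  rewrite /= size_rcons !ltnS; exact.
have sz3 : (3 <= size (x :: p1))%N.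
  have [/(_ 0%N) H1 /(_ 0%N) H2] := nb_walkP x _ nbc.
  case: (p1) nbc H1 H2 => [|y [|z q]] // _ /= H1 H2.
    by move: (H1 isT); rewrite simple_e.2.
  by move: (H2 isT); rewrite eqxx.
have := girth (x :: p1); rewrite /graph_cycle /ucycle sz3 cyc uc /= => /(_ (conj isT isT)).
move: szg; rewrite /= size_cat /= addnS => A B.
lia.
Qed.

(** Runs back along [t] to [w] and then out along [s]; the last hypothesis excludes backtracking at
    the junction [w]. *)
Lemma nb_walk_catrev w (s t : seq V) : nb_walk (w :: s) -> nb_walk (w :: t) ->
  (if (s, t) is (a :: _, b :: _) then a != b else true) ->
  nb_walk (catrev t (w :: s)).
Proof.
elim: t w s => [|b t IH] w s // ns; rewrite nb_walk_cons2 => /and3P[ewb wt nt] st.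
rewrite [catrev _ _]/=; apply: IH => //.
  rewrite nb_walk_cons2 simple_e.1 ewb ns andbT [_ && _]/=.
  by case: s st {ns} => // a s; rewrite eq_sym.
Qed.

(** Common first steps are stripped. Once the first steps differ, gluing the two walks at [w] gives
    a non-backtracking walk on at most [2 r + 1] vertices whose two ends coincide, against
    [nb_walk_uniq]. *)
Lemma nb_walk_inj (r : nat) w (s t : seq V) :
  (forall c, graph_cycle e c -> (2 * r < size c)%N) ->
  (size s <= r)%N -> size s = size t ->
  nb_walk (w :: s) -> nb_walk (w :: t) -> last w s = last w t -> s = t.
Proof.
move=> girth; elim: s t w => [|a s IH] [|b t] w // sr [st] ns nt lst.
have [ab|ab] := eqVneq a b.
  subst b; congr (_ :: _); apply: (IH t a) => //; first exact: ltnW.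
    by case/and3P: ns.
  by case/and3P: nt.
have nbw : nb_walk (rev (b :: t) ++ w :: a :: s).
  by rewrite -catrevE; exact: nb_walk_catrev.
have := @nb_walk_uniq (2 * r) _ girth nbw.
rewrite size_cat size_rev /= -st.
have -> : ((size s).+1 + (size s).+2 <= (2 * r).+1)%N.
  by rewrite addnS ltnS mul2n -addnn leq_add.
move=> /(_ isT); rewrite cat_uniq => /and3P[_ /negP H _]; exfalso; apply: H.
apply/hasP; exists (last a s); first by rewrite inE mem_last orbT.
by rewrite /= in lst; rewrite lst mem_rev mem_last.
Qed.

End NonBacktracking.

(** * The law of the walk *)

Section WalkLaw.
Variables (R : realType) (V : finType) (e : rel V) (d : nat).
Hypotheses (simple_e : simple_graph e) (regular_e : regular e d).
Hypothesis d_ge3 : (3 <= d)%N.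

Notation moves := (nb_moves e).
Notation prob := (nb_steps_prob R e).

Lemma unif_ge0 (A : {set V}) y : 0 <= unif R A y.
Proof. by rewrite /unif divr_ge0 // ler0n. Qed.

Lemma sum_unif (A : {set V}) : (0 < #|A|)%N -> \sum_y unif R A y = 1.
Proof.
move=> A0; rewrite /unif -big_distrl /= -natr_sum.
rewrite (eq_bigr (fun y => if y \in A then 1%N else 0%N)); last first.
  by move=> y _; case: (y \in A).
by rewrite -big_mkcond sum1_card divff // pnatr_eq0 -lt0n.
Qed.

Lemma card_nb_moves_None c : #|moves None c| = d.
Proof. by rewrite -(regular_e c); apply: eq_card => y; rewrite !inE andbT. Qed.

Lemma card_nb_moves_Some p c : e c p -> #|moves (Some p) c| = d.-1.
Proof.
move=> ecp; have := regular_e c; rewrite (cardsD1 p) inE ecp => <- /=.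
by apply: eq_card => y; rewrite !inE andbC; congr (_ && _).
Qed.

Lemma card_nb_moves_ge p c : (d.-1 <= #|moves p c|)%N.
Proof.
case: p => [p|]; last by rewrite card_nb_moves_None leq_pred.
have [ecp|ecp] := boolP (e c p); first by rewrite card_nb_moves_Some.
rewrite (leq_trans (leq_pred d)) // -(regular_e c); apply: subset_leq_card.
apply/fintype.subsetP => y; rewrite !inE => ecy; rewrite ecy /=.
by apply: contraNneq ecp => -[<-].
Qed.

Lemma card_nb_moves_gt0 p c : (0 < #|moves p c|)%N.
Proof. by apply: leq_trans (card_nb_moves_ge p c); lia. Qed.

Lemma nb_steps_prob_ge0 p c s : 0 <= prob p c s.
Proof. by elim: s p c => //= y s IH p c; rewrite mulr_ge0 ?unif_ge0. Qed.

Lemma sum_nb_steps_prob m p c : \sum_(s : m.-tuple V) prob p c s = 1.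
Proof.
elim: m p c => [|m IH] p c; first by rewrite (sum_tuple0 (prob p c)).
rewrite (sum_tuple_cons m (prob p c)) -[RHS](sum_unif (card_nb_moves_gt0 p c)).
by apply: eq_bigr => y _; rewrite -big_distrr /= IH mulr1.
Qed.

Fixpoint prev_after (p : option V) (c : V) (s : seq V) : option V :=
  if s is y :: s' then prev_after (Some c) y s' else p.

Lemma nb_steps_prob_cat p c s t :
  prob p c (s ++ t) = prob p c s * prob (prev_after p c s) (last c s) t.
Proof. by elim: s p c => [|y s IH] p c /=; rewrite ?mul1r // IH mulrA. Qed.

(** Coming from a neighbour, exactly [d.-1] moves are open at every step, so all non-backtracking
    continuations of one length are equally likely. *)
Lemma nb_steps_prob_Some p c s : e p c ->
  prob (Some p) c s = (nb_walk e (p :: c :: s))%:R / d.-1%:R ^+ size s.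
Proof.
elim: s p c => [|y s IH] p c epc.
  by rewrite /= epc divr1.
have -> : prob (Some p) c (y :: s) = unif R (moves (Some p) c) y * prob (Some c) y s by [].
rewrite nb_walk_cons2 epc /= /unif inE.
rewrite card_nb_moves_Some; last by rewrite simple_e.1.
have [ecy|necy] := boolP (e c y); last first.
  by rewrite /= !mul0r andbF mul0r.
rewrite IH // nb_walk_cons2 ecy /= exprS invfM.
rewrite (_ : (Some y != Some p) = (p != y)); last by rewrite eq_sym.
by case: (p != y) => /=; rewrite ?mul0r // mul1r mulrCA.
Qed.

Lemma nb_steps_prob_cons p c y s : prob p c (y :: s) =
  ((y \in moves p c) && nb_walk e (c :: y :: s))%:R /
    (#|moves p c| * d.-1 ^ size s)%:R.
Proof.
have -> : prob p c (y :: s) = unif R (moves p c) y * prob (Some c) y s by [].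
rewrite /unif; have [ym|ym] := boolP (y \in moves p c); last by rewrite !mul0r.
rewrite nb_steps_prob_Some; last by move: ym; rewrite inE => /andP[].
by rewrite /= natrM natrX invfM mul1r mulrCA.
Qed.

(** This is [nbrw_law] on plain sequences, where concatenation and reversal need no cast of lengths;
    the value at [[::]] is a default. *)
Definition walk_law (s : seq V) : R :=
  if s is x :: t then #|V|%:R^-1 * prob None x t else 0.

Lemma nbrw_law_seq L (u : L.+1.-tuple V) : nbrw_law R e u = walk_law u.
Proof.
case/tupleP: u => x u; rewrite /nbrw_law theadE /unif inE cardsT.
by rewrite mul1r.
Qed.

Lemma walk_law_ge0 s : 0 <= walk_law s.
Proof. by case: s => //= x t; rewrite mulr_ge0 ?nb_steps_prob_ge0 // invr_ge0. Qed.

Lemma walk_law_cons2 x y t : walk_law (x :: y :: t) =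
  (nb_walk e (x :: y :: t))%:R / (#|V| * (d * d.-1 ^ size t))%:R.
Proof.
rewrite /walk_law nb_steps_prob_cons card_nb_moves_None inE andbT.
rewrite nb_walk_cons2 [in RHS]natrM invfM mulrCA; case: (e x y) => //=.
Qed.

Lemma walk_law_gt0 s : 0 < walk_law s -> nb_walk e s.
Proof.
case: s => [|x [|y t]] //; rewrite ?ltxx // walk_law_cons2.
by case: nb_walk => //; rewrite mul0r ltxx.
Qed.

(** By [walk_law_cons2] the law is uniform on the non-backtracking walks of a given length, and
    these are closed under reversal. *)
Lemma walk_law_rev s : walk_law (rev s) = walk_law s.
Proof.
case: s => [|x [|y t]] //; have := nb_walk_rev simple_e [:: x, y & t].
have : size (rev [:: x, y & t]) = (size t).+2 by rewrite size_rev.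
case: (rev _) => [|a [|b q]] // [sq] nbE.
by rewrite !walk_law_cons2 sq nbE.
Qed.

Lemma sum_walk_law_cat m s : s != [::] ->
  \sum_(t : m.-tuple V) walk_law (s ++ t) = walk_law s.
Proof.
case: s => //= x s _; rewrite -big_distrr /=; congr (_ * _).
under eq_bigr => t _ do rewrite nb_steps_prob_cat.
by rewrite -big_distrr /= sum_nb_steps_prob mulr1.
Qed.

Lemma sum_walk_law_head m v :
  \sum_(t : m.-tuple V) walk_law (v :: t) = #|V|%:R^-1.
Proof.
by have := @sum_walk_law_cat m [:: v] isT; rewrite /= mulr1.
Qed.

Lemma sum_walk_law m : (0 < #|V|)%N -> \sum_(u : m.+1.-tuple V) walk_law u = 1.
Proof.
move=> V0; rewrite (sum_tuple_cons m walk_law).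
under eq_bigr => x _ do rewrite sum_walk_law_head.
by rewrite sumr_const -[_ *+ _]mulr_natl divff // pnatr_eq0 -lt0n.
Qed.

(** Reversal turns the last vertex into the first, which is uniform by definition. *)
Lemma sum_walk_law_last m x0 v :
  \sum_(u : m.+1.-tuple V) walk_law u * (last x0 u == v)%:R = #|V|%:R^-1.
Proof.
rewrite (sum_tuple_rev m.+1 (fun u => walk_law u * (last x0 u == v)%:R)).
rewrite (sum_tuple_cons m (fun u => walk_law (rev u) * (last x0 (rev u) == v)%:R)).
rewrite (bigD1 v) //= [X in _ + X]big1 ?addr0.
  rewrite -[RHS](sum_walk_law_head m v); apply: eq_bigr => t _.
  by rewrite rev_cons last_rcons eqxx mulr1 -rev_cons walk_law_rev.
move=> x xv; apply: big1 => t _.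
by rewrite rev_cons last_rcons (negPf xv) mulr0.
Qed.

End WalkLaw.

(** * One ball *)

Section OneStep.
Variables (R : realType) (V : finType) (e : rel V) (d r l : nat).
Hypotheses (simple_e : simple_graph e) (regular_e : regular e d).
Hypothesis d_ge3 : (3 <= d)%N.
Hypothesis r_gt0 : (0 < r)%N.

Notation prob := (nb_steps_prob R e).
Notation law := (walk_law R e).

(** All pairs [p], [w] are allowed, even non-adjacent ones, so that the bound can be iterated along
    a walk without tracking which states occur. *)
Definition sparse (H : {set V}) : bool :=
  [forall p : option V, forall w : V,
    \sum_(s : r.-tuple V) prob p w s * (last w s \in H)%:R <= 2^-1].

Lemma sparseS (A B : {set V}) : A \subset B -> sparse B -> sparse A.
Proof.
move=> /fintype.subsetP AB /forallP sB; apply/forallP => p; apply/forallP => w.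
move/forallP: (sB p) => /(_ w); apply: le_trans; apply: ler_sum => s _.
rewrite ler_wpM2l ?nb_steps_prob_ge0 // ler_nat.
by case: (boolP (_ \in A)) => // /AB ->.
Qed.

Section Discount.
Variables (x0 : V) (H : {set V}).
Hypothesis sparseH : sparse H.

(** The product over the choices is 1 when all of them lie in [H], and it is still bounded below
    when few lie outside; the first fact serves [step_law_high], the second [step_law_tie]. *)
Definition discount (x : V) : R := 2^-1 ^+ (x \notin H).

Lemma discount_ge0 x : 0 <= discount x.
Proof. by rewrite exprn_ge0 // invr_ge0. Qed.

Lemma discount_le1 x : discount x <= 1.
Proof. by rewrite exprn_ile1 ?invr_ge0 // invf_le1 // ler1n. Qed.

Lemma sum_discount_step p w :
  \sum_(s : r.-tuple V) prob p w s * discount (last w s) <= 3 / 4.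
Proof.
(* The discount is the mean of 1 and of the indicator of [H], whence [1/2 + 1/2 * 1/2 = 3/4]. *)
have -> : \sum_(s : r.-tuple V) prob p w s * discount (last w s) =
  2^-1 * \sum_(s : r.-tuple V) prob p w s +
  2^-1 * \sum_(s : r.-tuple V) prob p w s * (last w s \in H)%:R.
  rewrite !big_distrr -big_split /=; apply: eq_bigr => s _.
  by rewrite /discount; case: (_ \in H) => /=; rewrite ?expr0 ?expr1; field.
rewrite (sum_nb_steps_prob R regular_e d_ge3).
by have := forallP (forallP sparseH p) w; lra.
Qed.

(** Markov property, one block of [r] steps at a time. As [s] omits the starting vertex, block [j]
    ends at index [j * r + r.-1]. *)
Lemma sum_discount_walk m p w :
  \sum_(s : (m * r).-tuple V)
    prob p w s * \prod_(j < m) discount (nth x0 s (j * r + r.-1)) <= (3 / 4) ^+ m.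
Proof.
elim: m p w => [|m IH] p w.
  rewrite (sum_tuple0 (fun s => prob p w s *
    \prod_(j < 0) discount (nth x0 s (j * r + r.-1)))) /= big_ord0.
  by rewrite mulr1 expr0.
pose F s := prob p w s * \prod_(j < m.+1) discount (nth x0 s (j * r + r.-1)).
rewrite -[leLHS]/(\sum_(s : (r + m * r).-tuple V) F s) sum_tuple_cat.
apply: (@le_trans _ _ (\sum_(s : r.-tuple V)
    prob p w s * discount (last w s) * (3 / 4) ^+ m)); last first.
  rewrite -big_distrl /= exprS; apply: ler_wpM2r (sum_discount_step p w).
  by rewrite exprn_ge0.
apply: ler_sum => s _.
apply: le_trans (ler_wpM2l _ (IH (prev_after p w s) (last w s))); last first.
  by rewrite mulr_ge0 ?nb_steps_prob_ge0 ?discount_ge0.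
rewrite big_distrr /=; apply: ler_sum => t _.
rewrite /F nb_steps_prob_cat big_ord_recl /= mul0n add0n.
rewrite nth_cat size_tuple prednK // leqnn.
have -> : nth x0 s r.-1 = last w s.
  have := size_tuple s; case: (tval s) => [|a s'] /= sz.
    by move: r_gt0; rewrite -sz.
  by rewrite -sz (last_nth x0).
rewrite (eq_bigr (fun j : 'I_m => discount (nth x0 t (j * r + r.-1)))).
  by rewrite mulrACA.
move=> j _; rewrite /bump /= add1n mulSn -addnA nth_cat size_tuple.
by rewrite ltnNge leq_addr /= addKn.
Qed.

(** The prefix up to choice [j] ends at [v] with probability [1 / n] by stationarity. Discounts up
    to that choice are bounded by 1, and each of the [l - j] later blocks gains a factor 3/4. *)
Lemma sum_discount_after j v : (j <= l)%N ->
  \sum_(u : (l * r).+1.-tuple V)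
    law u * (nth x0 u (j * r) == v)%:R *
    \prod_(i < l.+1) discount (nth x0 u (i * r)) <= #|V|%:R^-1 * (3 / 4) ^+ (l - j).
Proof.
move=> jl.
(* [F] takes sequences, so the length in the index type can be rewritten with [el] without casts. *)
pose F u := law u * (nth x0 u (j * r) == v)%:R *
    \prod_(i < l.+1) discount (nth x0 u (i * r)).
have el : ((l * r).+1 = (j * r).+1 + (l - j) * r)%N.
  by rewrite addSn -mulnDl subnKC.
rewrite -[leLHS]/(\sum_(u : (l * r).+1.-tuple V) F u) el sum_tuple_cat.
apply: (@le_trans _ _ (\sum_(s : (j * r).+1.-tuple V)
    law s * (last x0 s == v)%:R * (3 / 4) ^+ (l - j))); last first.
  by rewrite -big_distrl /= (sum_walk_law_last R simple_e regular_e d_ge3).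
apply: ler_sum => s _.
have szs : size s = (j * r).+1 by rewrite size_tuple.
case: s szs => [[|x s] Hs] // /= [szs].
rewrite -mulrA.
apply: le_trans (ler_wpM2l _ (ler_wpM2l _ (sum_discount_walk (l - j)
   (prev_after None x s) (last x s)))); last 2 first.
- by rewrite ?mulr_ge0 ?nb_steps_prob_ge0 ?invr_ge0 ?ler0n.
- by rewrite ?mulr_ge0 ?nb_steps_prob_ge0 ?invr_ge0 ?ler0n.
rewrite !big_distrr /=; apply: ler_sum => t _.
rewrite /F /= nb_steps_prob_cat.
rewrite -cat_cons nth_cat /= szs ltnSn.
rewrite (_ : nth x0 (x :: s) (j * r) = last x s); last first.
  by rewrite -szs nth_last.
rewrite [leRHS](_ : _ = #|V|%:R^-1 *
    (prob None x s * prob (prev_after None x s) (last x s) t) *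
    (last x s == v)%:R * \prod_(i < l - j) discount (nth x0 t (i * r + r.-1)));
  last by ring.
apply: ler_wpM2l.
  by rewrite ?mulr_ge0 ?nb_steps_prob_ge0 ?invr_ge0 ?ler0n.
rewrite -(big_mkord xpredT (fun i => discount (nth x0 (x :: s ++ t) (i * r)))).
rewrite (@big_cat_nat _ _ _ j.+1) //= ?ltnS //.
rewrite -[leRHS]mul1r; apply: ler_pM.
- by apply: prodr_ge0 => i _; exact: discount_ge0.
- by apply: prodr_ge0 => i _; exact: discount_ge0.
- by apply: prodr_ile1 => i _; rewrite discount_ge0 discount_le1.
rewrite -(add0n j.+1) big_addn subSS big_mkord.
apply: ler_prod => i _; rewrite discount_ge0 /=.
rewrite -cat_cons nth_cat /= szs.
have -> : ((i + j.+1) * r = (j * r).+1 + (i * r + r.-1))%N.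
  by rewrite mulnDl mulSn; lia.
by rewrite ltnNge leq_addr /= addKn.
Qed.

Lemma nth_rev_choice (u : seq V) j : size u = (l * r).+1 -> (j <= l)%N ->
  nth x0 (rev u) (j * r) = nth x0 u ((l - j) * r).
Proof.
move=> su jl; have jr : (j * r <= l * r)%N by rewrite leq_mul2r jl orbT.
by rewrite nth_rev su ?ltnS // subSS mulnBl.
Qed.

(** Reversal exchanges choice [j] with choice [l - j], and the choices before with those after. *)
Lemma sum_discount_before j v : (j <= l)%N ->
  \sum_(u : (l * r).+1.-tuple V)
    law u * (nth x0 u (j * r) == v)%:R *
    \prod_(i < l.+1) discount (nth x0 u (i * r)) <= #|V|%:R^-1 * (3 / 4) ^+ j.
Proof.
move=> jl; rewrite -{2}(subKn jl).
apply: le_trans (sum_discount_after v (leq_subr j l)).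
rewrite (sum_tuple_rev _ (fun u => law u * (nth x0 u (j * r) == v)%:R *
    \prod_(i < l.+1) discount (nth x0 u (i * r)))).
apply: ler_sum => u _; have su := size_tuple u.
rewrite (walk_law_rev R simple_e regular_e) nth_rev_choice // (reindex_inj rev_ord_inj) /=.
apply: ler_wpM2l; first by rewrite mulr_ge0 ?ler0n // walk_law_ge0.
apply: ler_prod => i _; rewrite discount_ge0 /= subSS.
by rewrite nth_rev_choice ?leq_subr // subKn // -ltnS.
Qed.

End Discount.

Lemma choicesP x0 (u : walk V r l) v :
  reflect (exists j : 'I_l.+1, nth x0 u (j * r) = v) (v \in choices u).
Proof.
have tE (j : 'I_l.+1) : tnth u (inord (j * r)) = nth x0 u (j * r).
  by rewrite (tnth_nth x0) inordK // ltnS leq_mul2r -ltnS ltn_ord orbT.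
apply: (iffP imsetP) => [[j _ ->]|[j <-]]; exists j => //; exact: tE.
Qed.

Lemma choices_indic x0 (u : walk V r l) v :
  (v \in choices u)%:R <= \sum_(j < l.+1) (nth x0 u (j * r) == v)%:R :> R.
Proof.
case: (choicesP x0 u v) => [[j <-]|_]; last by apply: sumr_ge0.
by rewrite (bigD1 j) //= eqxx lerDl; apply: sumr_ge0.
Qed.

Lemma law_tuple (u : walk V r l) : nbrw_law R e u = law u.
Proof. exact: nbrw_law_seq. Qed.

Lemma choices_law v :
  \sum_(u : walk V r l) law u * (v \in choices u)%:R <= l.+1%:R / #|V|%:R.
Proof.
apply: (@le_trans _ _ (\sum_(u : walk V r l) \sum_(j < l.+1)
    law u * (nth v u (j * r) == v)%:R)).
  apply: ler_sum => u _; rewrite -big_distrr /=; apply: ler_wpM2l.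
    exact: walk_law_ge0.
  exact: choices_indic.
rewrite exchange_big /=.
apply: (@le_trans _ _ (\sum_(j < l.+1) #|V|%:R^-1)); last first.
  by rewrite sumr_const card_ord -[_ *+ _]mulr_natl.
apply: ler_sum => j _; have jl : (j <= l)%N by rewrite -ltnS.
have el : ((l * r).+1 = (j * r).+1 + (l - j) * r)%N.
  by rewrite addSn -mulnDl subnKC.
pose F u := law u * (nth v u (j * r) == v)%:R.
rewrite -[leLHS]/(\sum_(u : (l * r).+1.-tuple V) F u) el sum_tuple_cat.
rewrite -[leRHS](sum_walk_law_last R simple_e regular_e d_ge3 (j * r) v v).
apply: ler_sum => s _.
have sn : (s : seq V) != [::] by rewrite -size_eq0 size_tuple.
rewrite -[in leRHS](sum_walk_law_cat R regular_e d_ge3 ((l - j) * r) sn).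
rewrite big_distrl /=; apply: ler_sum => t _.
by rewrite /F nth_cat size_tuple ltnSn (last_nth v) size_tuple.
Qed.

(** Union bound over the position [j] of [v]: one of [j] and [l - j] is at least [l./2], and the
    longer side of the walk is used. *)
Lemma choices_discount x0 H v : sparse H ->
  \sum_(u : walk V r l) law u * (v \in choices u)%:R *
    \prod_(i < l.+1) discount H (nth x0 u (i * r)) <=
  l.+1%:R * (3 / 4) ^+ l./2 / #|V|%:R.
Proof.
move=> sH; apply: (@le_trans _ _ (\sum_(u : walk V r l) \sum_(j < l.+1)
    law u * (nth x0 u (j * r) == v)%:R *
      \prod_(i < l.+1) discount H (nth x0 u (i * r)))).
  apply: ler_sum => u _; rewrite -big_distrl /= -big_distrr /=; apply: ler_wpM2r.
    by apply: prodr_ge0 => i _; exact: discount_ge0.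
  by apply: ler_wpM2l (choices_indic x0 u v); exact: walk_law_ge0.
rewrite exchange_big /=.
apply: (@le_trans _ _ (\sum_(j < l.+1) #|V|%:R^-1 * (3 / 4) ^+ l./2)); last first.
  by rewrite sumr_const card_ord -[_ *+ _]mulr_natl mulrC mulrAC [leRHS]mulrC mulrA.
apply: ler_sum => j _; have jl : (j <= l)%N by rewrite -ltnS.
have pow m : (l./2 <= m)%N ->
  #|V|%:R^-1 * (3 / 4) ^+ m <= #|V|%:R^-1 * (3 / 4) ^+ l./2 :> R.
  move=> lm; apply: ler_wpM2l; first by rewrite invr_ge0 ler0n.
  by apply: ler_wiXn2l => //; lra.
have [lj|lj] := leqP l./2 j.
  exact: le_trans (sum_discount_before x0 sH v jl) (pow _ lj).
apply: le_trans (sum_discount_after x0 sH v jl) (pow _ _).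
by have := odd_double_half l; lia.
Qed.

Definition step_law (ld : V -> nat) (x : walk V r l * V) : R :=
  nbrw_law R e x.1 * unif R (least_loaded ld (choices x.1)) x.2.

Lemma step_law_ge0 ld x : 0 <= step_law ld x.
Proof. by rewrite /step_law law_tuple mulr_ge0 ?walk_law_ge0 ?unif_ge0. Qed.

Lemma least_loaded_gt0 (ld : V -> nat) (u : walk V r l) :
  (0 < #|least_loaded ld (choices u)|)%N.
Proof.
have [v vu] : exists v, v \in choices u.
  by exists (tnth u (inord (@ord0 l * r))); apply: imset_f.
case: (arg_minnP ld vu) => w wu wmin; apply/card_gt0P; exists w.
rewrite inE (wu : w \in choices u).
by apply/forallP => x; apply/implyP => xu; exact: wmin.
Qed.

Lemma sum_step_law ld : (0 < #|V|)%N -> \sum_x step_law ld x = 1.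
Proof.
move=> V0; rewrite -(sum_walk_law R regular_e d_ge3 (l * r) V0).
rewrite -(pair_big xpredT xpredT (fun u v => step_law ld (u, v))) /=.
apply: eq_bigr => u _; rewrite /step_law /= -mulr_sumr law_tuple.
by rewrite sum_unif ?mulr1 // least_loaded_gt0.
Qed.

Lemma unif_le1 (A : {set V}) y : unif R A y <= (y \in A)%:R.
Proof.
rewrite /unif; case: (boolP (y \in A)) => yA; last by rewrite mul0r.
rewrite mul1r invf_le1 ?ltr0n ?ler1n //; by apply/card_gt0P; exists y.
Qed.

(** A ball put on [v] finds all its choices at least as loaded as [v], hence in [H], so its discount
    is 1 and [choices_discount] applies. *)
Lemma step_law_high ld i v : sparse [set x | (i <= ld x)%N]%SET -> (i <= ld v)%N ->
  \sum_u step_law ld (u, v) <= l.+1%:R * (3 / 4) ^+ l./2 / #|V|%:R.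
Proof.
set H := [set x | _]%SET => sH iv.
apply: le_trans (choices_discount v v sH); apply: ler_sum => u _.
rewrite /step_law /= law_tuple -mulrA; apply: ler_wpM2l; first exact: walk_law_ge0.
apply: le_trans (unif_le1 _ _) _; rewrite inE.
have P0 : 0 <= \prod_(j < l.+1) discount H (nth v u (j * r)).
  by apply: prodr_ge0 => j _; exact: discount_ge0.
case: (boolP (v \in _)) => vu /=; last by rewrite mul0r.
case: forallP => [vmin|_]; last by rewrite mul1r.
rewrite mul1r big1 // => j _; rewrite /discount inE.
have /implyP := vmin (nth v u (j * r)).
have -> : nth v u (j * r) \in choices u by apply/(choicesP v); exists j.
by move=> /(_ isT) vj; rewrite (leq_trans iv vj).
Qed.

Lemma choices_inj x0 (u : walk V r l) : uniq u ->
  injective (fun j : 'I_l.+1 => nth x0 u (j * r)).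
Proof.
move=> uu i j /eqP; have lt (k : 'I_l.+1) : (k * r < size u)%N.
  by rewrite size_tuple ltnS leq_mul2r -ltnS ltn_ord orbT.
by rewrite nth_uniq // eqn_pmul2r // => /eqP; exact: val_inj.
Qed.

Lemma card_choices (x0 : V) (u : walk V r l) : uniq u -> #|choices u| = l.+1.
Proof.
move=> uu; rewrite -[RHS]card_ord -cardsT -(card_imset _ (choices_inj (x0 := x0) uu)).
apply: eq_card => v; apply/choicesP/imsetP => [[j <-]|[j _ ->]]; by exists j.
Qed.

(* [q = l / 16] balances the two error terms: either more than [q] choices have
   load [i], and then [v] is picked with probability at most [1 / q.+1], or the
   discount of the walk is at least [2 ^- q]. *)
Lemma step_law_tie ld i v :
  (forall c, graph_cycle e c -> (l * r < size c)%N) ->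
  sparse [set x | (i < ld x)%N]%SET -> ld v = i ->
  \sum_u step_law ld (u, v) <= 32 / #|V|%:R.
Proof.
set H := [set x | _]%SET => girth sH iv; set q := (l %/ 16)%N.
have V0 : (0 < #|V|)%N by apply/card_gt0P; exists v.
apply: (@le_trans _ _ (\sum_(u : walk V r l) (law u * (v \in choices u)%:R / q.+1%:R
   + 2 ^+ q * (law u * (v \in choices u)%:R *
    \prod_(j < l.+1) discount H (nth v u (j * r)))))).
  apply: ler_sum => u _; rewrite /step_law /= law_tuple.
  have L0 := walk_law_ge0 R e u.
  have [L1|/eqP L1] := boolP (law u == 0); first by rewrite (eqP L1) !mul0r mulr0 addr0.
  have Lp : 0 < law u by rewrite lt_def L0 andbT; apply/eqP.
  have uu : uniq u.
    apply: (nb_walk_uniq simple_e girth); first by apply: walk_law_gt0 Lp.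
    by rewrite size_tuple.
  rewrite [leRHS](_ : _ = law u * ((v \in choices u)%:R * (q.+1%:R^-1 +
    2 ^+ q * \prod_(j < l.+1) discount H (nth v u (j * r))))); last by ring.
  apply: ler_wpM2l => //.
  have P0 : 0 <= \prod_(j < l.+1) discount H (nth v u (j * r)).
    by apply: prodr_ge0 => j _; exact: discount_ge0.
  rewrite /unif; case: (boolP (v \in _)) => vl; last first.
    rewrite mul0r mulr_ge0 ?ler0n // addr_ge0 ?invr_ge0 ?ler0n //.
    by rewrite mulr_ge0 // exprn_ge0.
  move: (vl); rewrite inE => /andP[vu /forallP vmin]; rewrite vu !mul1r.
  (* As [v] is a least loaded choice and has load [i], the choices outside [H] are exactly the least
     loaded ones; they are counted without repetition because the walk is duplicate-free. *)
  have pE : \prod_(j < l.+1) discount H (nth v u (j * r)) =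
     2^-1 ^+ #|least_loaded ld (choices u)|.
    rewrite -expr_sum; congr (_ ^+ _).
    transitivity #|[set j : 'I_l.+1 | nth v u (j * r) \notin H]%SET|.
      rewrite -sum1_card [in RHS]big_mkcond /=; apply: eq_bigr => j _.
      by rewrite !inE; case: (_ < _)%N.
    rewrite -(card_imset _ (choices_inj (x0 := v) uu)); apply: eq_card => x.
    rewrite [in RHS]inE; apply/imsetP/andP.
      move=> [j]; rewrite inE => jH ->; split; first by apply/(choicesP v); exists j.
      apply/forallP => y; apply/implyP => yu.
      move: jH; rewrite inE -leqNgt => jH; apply: leq_trans jH _; rewrite -iv.
      by move/implyP: (vmin y); apply.
    move=> [xu /forallP /(_ v)]; rewrite vu iv /= => xi.
    case/(choicesP v): xu => j jx; exists j => //; rewrite inE jx inE -leqNgt //.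
  set Y := #|_| in pE *.
  have Y0 : (0 < Y)%N by apply: least_loaded_gt0.
  rewrite pE; have [Yq|Yq] := leqP Y q.
    apply: (@le_trans _ _ 1); first by rewrite invf_le1 ?ltr0n ?ler1n.
    rewrite ler_wpDl ?invr_ge0 ?ler0n // exprVn ler_pdivlMr ?exprn_gt0 // mul1r.
    by apply: ler_weXn2l => //; rewrite ler1n.
  rewrite ler_wpDr ?mulr_ge0 ?exprn_ge0 ?invr_ge0 //.
  by rewrite lef_pV2 ?posrE ?ltr0n // ler_nat.
rewrite big_split /= -big_distrl /= -big_distrr /=.
have A := choices_law v; have B := choices_discount v v sH.
(* Each of the two terms will be at most [16 / n]: [2 * (3/4)^8 <= 1/2], so the second factor is at
   most [2^-q], and [q < 2^q]. *)
have q1 : (l.+1 <= 16 * q.+1)%N by rewrite /q; lia.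
have q8 : (8 * q <= l./2)%N by rewrite /q; have := odd_double_half l; lia.
have tail : 2 ^+ q * (3 / 4) ^+ l./2 <= q.+1%:R^-1 :> R.
  apply: (@le_trans _ _ (2 ^+ q * (3 / 4) ^+ (8 * q))).
    by apply: ler_wpM2l; rewrite ?exprn_ge0 //; apply: ler_wiXn2l => //; lra.
  rewrite exprM -exprMn; apply: (@le_trans _ _ (2^-1 ^+ q)).
    by apply: lerXn2r; rewrite ?nnegrE; lra.
  rewrite exprVn lef_pV2 ?posrE ?exprn_gt0 ?ltr0n // -natrX ler_nat.
  exact: ltn_expl.
have lq : l.+1%:R / q.+1%:R <= 16 :> R.
  by rewrite ler_pdivrMr ?ltr0n // -natrM ler_nat.
apply: (@le_trans _ _ (l.+1%:R / #|V|%:R / q.+1%:R +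
   2 ^+ q * (l.+1%:R * (3 / 4) ^+ l./2 / #|V|%:R))).
  by apply: lerD; [apply: ler_wpM2r|apply: ler_wpM2l]; rewrite ?invr_ge0 ?exprn_ge0.
have -> : l.+1%:R / #|V|%:R / q.+1%:R + 2 ^+ q * (l.+1%:R * (3 / 4) ^+ l./2 / #|V|%:R)
  = (l.+1%:R / q.+1%:R + l.+1%:R * (2 ^+ q * (3 / 4) ^+ l./2)) / #|V|%:R :> R by ring.
apply: ler_wpM2r; first by rewrite invr_ge0 ler0n.
have : l.+1%:R * (2 ^+ q * (3 / 4) ^+ l./2) <= l.+1%:R * q.+1%:R^-1 :> R.
  by apply: ler_wpM2l.
move=> /le_trans /(_ lq) C; rewrite (_ : 32 = 16 + 16); last by ring.
exact: lerD.
Qed.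

End OneStep.

(** * Spheres and loads *)

Section Reach.
Variables (R : realType) (V : finType) (e : rel V) (d r : nat).
Hypotheses (simple_e : simple_graph e) (regular_e : regular e d).
Hypothesis d_ge3 : (3 <= d)%N.
Hypothesis r_gt0 : (0 < r)%N.
Hypothesis girth_r : forall c, graph_cycle e c -> (2 * r < size c)%N.

Notation prob := (nb_steps_prob R e).

Definition reach_steps p w : {set r.-tuple V} := [set s : r.-tuple V | prob p w s != 0]%SET.

Definition reach p w : {set V} := [set last w s | s : r.-tuple V in reach_steps p w]%SET.

(** The number of non-backtracking continuations of length [r]: only the first step depends on [p],
    the others have [d.-1] options each. *)
Definition reach_count p w : nat := (#|nb_moves e p w| * d.-1 ^ r.-1)%N.

Lemma reach_count_ge p w : (d.-1 ^ r <= reach_count p w)%N.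
Proof.
rewrite /reach_count -[X in (_ ^ X)%N](prednK r_gt0) expnS leq_mul2r.
by rewrite (card_nb_moves_ge regular_e) orbT.
Qed.

Lemma reach_count_gt0 p w : (0 < reach_count p w)%N.
Proof. by apply: leq_trans (reach_count_ge p w); rewrite expn_gt0; lia. Qed.

Lemma nb_steps_prob_reach p w (s : r.-tuple V) :
  prob p w s = (s \in reach_steps p w)%:R / (reach_count p w)%:R.
Proof.
rewrite inE; have := size_tuple s; case: (tval s) => [|y t] /= sz.
  by move: r_gt0; rewrite -sz.
rewrite -/(prob p w (y :: t)) (nb_steps_prob_cons R simple_e regular_e).
rewrite (_ : size t = r.-1) -/(reach_count p w); last by rewrite -sz.
have N0 : (reach_count p w)%:R != 0 :> R by rewrite pnatr_eq0 -lt0n reach_count_gt0.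
by case: (_ && _); rewrite ?mul0r ?eqxx ?mul0r // mul1r invr_eq0 N0 mul1r.
Qed.

(** Counted through probability: the law has constant mass [1 / reach_count] on this set and total
    mass 1. *)
Lemma card_reach_steps p w : #|reach_steps p w| = reach_count p w.
Proof.
have N0 : (reach_count p w)%:R != 0 :> R by rewrite pnatr_eq0 -lt0n reach_count_gt0.
have := sum_nb_steps_prob R regular_e d_ge3 r p w.
under eq_bigr => s _ do rewrite nb_steps_prob_reach.
rewrite -big_distrl /= -natr_sum.
rewrite (eq_bigr (fun s => if s \in reach_steps p w then 1%N else 0%N)); last first.
  by move=> s _; case: (s \in _).
rewrite -big_mkcond sum1_card => /(congr1 (fun x => x * (reach_count p w)%:R)).
by rewrite mulfVK // mul1r => /eqP; rewrite eqr_nat => /eqP.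
Qed.

Lemma card_reach p w : (#|reach p w| <= reach_count p w)%N.
Proof. by rewrite -card_reach_steps leq_imset_card. Qed.

Lemma reach_nb_walk p w (s : r.-tuple V) : s \in reach_steps p w -> nb_walk e (w :: s).
Proof.
rewrite inE; have := size_tuple s; case: (tval s) => [|y t] //= sz.
rewrite -/(prob p w (y :: t)) (nb_steps_prob_cons R simple_e regular_e).
by rewrite -/(nb_walk e (w :: y :: t)); case: nb_walk => //; rewrite andbF mul0r eqxx.
Qed.

(** The girth makes the endpoint map injective on [reach_steps], by [nb_walk_inj], so equally likely
    walks have distinct endpoints. *)
Lemma escape_reach p w (H : {set V}) :
  \sum_(s : r.-tuple V) prob p w s * (last w s \in H)%:R <=
  #|H :&: reach p w|%:R / (reach_count p w)%:R.
Proof.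
under eq_bigr => s _ do rewrite nb_steps_prob_reach mulrAC -natrM mulnb.
rewrite -big_distrl /= -natr_sum ler_wpM2r ?invr_ge0 ?ler0n // ler_nat.
rewrite (eq_bigr (fun s : r.-tuple V =>
   if s \in [set s in reach_steps p w | last w s \in H]%SET then 1%N else 0%N)); last first.
  by move=> s _; rewrite [in RHS]inE; case: (_ && _).
rewrite -big_mkcond sum1_card.
rewrite -(card_in_imset (f := fun s : r.-tuple V => last w s)).
  apply: subset_leq_card; apply/fintype.subsetP => x /imsetP[s].
  rewrite inE => /andP[sr sH] ->; rewrite inE sH /=; exact: imset_f.
move=> s t; rewrite !inE => /andP[sr _] /andP[tr _] st; apply: val_inj.
apply: (nb_walk_inj simple_e girth_r (w := w)); rewrite ?size_tuple //.
  by apply: (@reach_nb_walk p); rewrite inE.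
by apply: (@reach_nb_walk p); rewrite inE.
Qed.

End Reach.

(** * Loads read off the history of a run *)

Section Loads.
Variables (R : realType) (V : finType) (e : rel V) (r l : nat).

Notation T := (walk V r l * V)%type.
Notation n := #|V|.

Definition seq_load (s : seq T) (v : V) : nat := count (fun x => x.2 == v) s.

Definition high (i : nat) (s : seq T) : {set V} := [set v | (i <= seq_load s v)%N]%SET.

Lemma load_hist (om : run V r l) (t : nat) v : (t <= n)%N ->
  load om t v = seq_load (take t (hist om)) v.
Proof.
elim: t => [|t IH] tn.
  by rewrite take0 /load /=; apply: eq_card0 => s; rewrite inE.
pose o := Ordinal tn.
rewrite (take_nth (om o)) ?size_hist // -cats1 /seq_load count_cat /= addn0.
rewrite -/(seq_load _ v) -IH; last exact: ltnW.
rewrite (_ : t = o :> nat) // nth_hist /load (cardsD1 o) inE ltnS leqnn addnC /=.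
congr (_ + _)%N; apply: eq_card => s; rewrite !inE ltnS /=.
rewrite -val_eqE /= ltn_neqAle; case: eqP => [->|_] //=; by rewrite ltnn.
Qed.

Lemma seq_load_take (om : run V r l) (t : 'I_n) v :
  seq_load (take t.+1 (hist om)) v = (seq_load (take t (hist om)) v + ((om t).2 == v))%N.
Proof.
rewrite (take_nth (om t)) ?size_hist // -cats1 /seq_load count_cat /= addn0.
by rewrite nth_hist.
Qed.

(** Loads grow by at most one per ball, so no level is skipped. *)
Lemma seq_load_cross (om : run V r l) (t i : nat) v : (t <= n)%N ->
  (i < seq_load (take t (hist om)) v)%N ->
  exists s : 'I_n, [/\ (s < t)%N, (om s).2 = v & seq_load (take s (hist om)) v = i].
Proof.
elim: t => [|t IH] tn; first by rewrite take0.
rewrite (seq_load_take om (Ordinal tn)) /= => Hi.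
have [il|il] := ltnP i (seq_load (take t (hist om)) v).
  have [|s [st sv si]] := IH _ il; first exact: ltnW.
  by exists s; split=> //; rewrite ltnW.
exists (Ordinal tn); move: Hi; case: eqP => [ov|_] /= Hi; last first.
  by move: Hi; rewrite addn0 ltnNge il.
by split=> //=; apply/eqP; rewrite eqn_leq il; move: Hi; rewrite addn1 ltnS.
Qed.

Definition run_step (s : seq T) (x : T) : R := step_law R e (seq_load s) x.

Lemma run_law_kernel (om : run V r l) : run_law R e om = run_kernel run_step om.
Proof.
apply: eq_bigr => t _; rewrite /run_step /step_law.
have -> : load om t = seq_load (take t (hist om)); last by [].
by apply: funext => v; rewrite load_hist // ltnW.
Qed.

Lemma sum_step_law_on (ld : V -> nat) (S : {set V}) (Q : pred V) (c : R) : 0 <= c ->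
  (forall v, v \in S -> Q v -> \sum_(u : walk V r l) step_law R e ld (u, v) <= c) ->
  \sum_(x : T | (x.2 \in S) && Q x.2) step_law R e ld x <= #|S|%:R * c.
Proof.
move=> c0 Hc.
rewrite -(pair_big_dep xpredT (fun _ v => (v \in S) && Q v)
  (fun (u : walk V r l) v => step_law R e ld (u, v))) /=.
rewrite (exchange_big_dep xpredT) //=.
rewrite (eq_bigr (fun v => if (v \in S) && Q v then
  \sum_(u : walk V r l) step_law R e ld (u, v) else 0)); last first.
  by move=> v _; case: ifP => h; [|rewrite big_pred0].
rewrite -sum1_card natr_sum big_distrl /= [leRHS]big_mkcond.
apply: ler_sum => v _; case: (boolP (v \in S)) => //= vS; rewrite mul1r.
by case: ifP => // Qv; exact: Hc.
Qed.

End Loads.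

(** * Tail of the maximum load *)

Section FiniteBound.
Variables (R : realType) (V : finType) (e : rel V) (d r l M : nat).
Hypotheses (simple_e : simple_graph e) (regular_e : regular e d).
Hypothesis d_ge3 : (3 <= d)%N.
Hypothesis r_gt0 : (0 < r)%N.
Hypothesis l_gt0 : (0 < l)%N.
Hypothesis girth_2r : forall c, graph_cycle e c -> (2 * r < size c)%N.
Hypothesis girth_lr : forall c, graph_cycle e c -> (l * r < size c)%N.
Hypothesis M_large : 2 * 32 ^+ 2 <= M%:R :> R.
Hypothesis n_large : (M <= #|V|)%N.

Notation n := #|V|.
Notation T := (walk V r l * V)%type.
Let eps : R := l.+1%:R * (3 / 4) ^+ l./2.
Hypothesis eps_small : eps <= 32^-1.

(** The [.+1] makes [M] phases cover all [n] balls. Phases are numbered from 1, since the phase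
    number also serves as the load threshold that has to stay sparse. *)
Definition phase_len : nat := (n %/ M).+1.
Definition phase (t : nat) : nat := (t %/ phase_len).+1.

Lemma M_gt0 : (0 < M)%N.
Proof. by rewrite -(ltr_nat R) (lt_le_trans _ M_large) // mulr_gt0 // exprn_gt0. Qed.

Lemma phase_le t : (t < n)%N -> (phase t <= M)%N.
Proof.
move=> tn; rewrite /phase ltn_divLR // mulnC.
by apply: ltn_trans tn _; rewrite /phase_len; apply: ltn_ceil M_gt0.
Qed.

Lemma leq_phase s t : (s <= t)%N -> (phase s <= phase t)%N.
Proof. by move=> st; rewrite ltnS leq_div2r. Qed.

Lemma sum_phase i : (\sum_(t < n) (phase t == i.+1) <= phase_len)%N.
Proof.
rewrite (eq_bigr (fun t : 'I_n => if t \in [set t : 'I_n | phase t == i.+1]%SET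
  then 1%N else 0%N)); last by move=> t _; rewrite inE; case: eqP.
rewrite -big_mkcond sum1_card.
pose f (t : 'I_n) : 'I_phase_len := inord (t %% phase_len).
have fi : {in [set t : 'I_n | phase t == i.+1]%SET &, injective f}.
  move=> s t; rewrite !inE eqSS => /eqP si; rewrite eqSS => /eqP ti.
  move/(congr1 val); rewrite /= !inordK ?ltn_mod // => st; apply: val_inj => /=.
  by rewrite (divn_eq s phase_len) (divn_eq t phase_len) si ti st.
by rewrite -(card_in_imset fi) -[leqRHS]card_ord max_card.
Qed.

(** Sparsity is part of the event, so that its conditional probability is bounded after every
    history; on calm runs [calm_sparse] supplies it. *)
Definition phase_hit (i : nat) (S : {set V}) (s : seq T) (x : T) : bool :=
  [&& (phase (size s) <= i.+1)%N, sparse R e r (high (phase (size s)) s),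
      x.2 \in S & seq_load s x.2 == i].

Definition late_hit (U : {set V}) (s : seq T) (x : T) : bool :=
  [&& sparse R e r (high M s), x.2 \in U & (M <= seq_load s x.2)%N].

Lemma eps_ge0 : 0 <= eps.
Proof. by rewrite mulr_ge0 // exprn_ge0. Qed.

Lemma eps_gt0 : 0 < eps.
Proof. by rewrite mulr_gt0 // exprn_gt0. Qed.

Lemma n_gt0 : (0 < n)%N.
Proof. exact: leq_trans M_gt0 n_large. Qed.

(** In phase [i.+1] a bin of load [i] is just below the sparse level and random ties give [32 / n];
    in earlier phases it already belongs to the sparse set, and [eps / n] holds. *)
Lemma phase_hit_prob i S s :
  \sum_(x | phase_hit i S s x) run_step R e s x <=
  #|S|%:R * (32 * (phase (size s) == i.+1)%:R + eps) / n%:R.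
Proof.
rewrite -mulrA; set c := _ / n%:R.
have c0 : 0 <= c by rewrite divr_ge0 // addr_ge0 ?eps_ge0 // mulr_ge0.
rewrite /phase_hit.
have [pi|pi] := leqP (phase (size s)) i.+1; last first.
  by rewrite big_pred0 // mulr_ge0.
have [sp|sp] := boolP (sparse R e r (high (phase (size s)) s)); last first.
  by rewrite big_pred0 // mulr_ge0.
apply: (sum_step_law_on (Q := fun v => seq_load s v == i)) => // v vS /eqP vi.
have [pe|pe] := eqVneq (phase (size s)) i.+1.
  rewrite pe in sp.
  apply: le_trans (step_law_tie simple_e regular_e d_ge3 r_gt0 girth_lr sp vi) _.
  by rewrite /c pe eqxx ler_wpM2r ?invr_ge0 // mulr1 lerDl eps_ge0.
have iv : (phase (size s) <= seq_load s v)%N by rewrite vi -ltnS ltn_neqAle pe.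
apply: le_trans (step_law_high l simple_e regular_e d_ge3 r_gt0 sp iv) _.
by rewrite /c (negPf pe) mulr0 add0r.
Qed.

Lemma late_hit_prob U s :
  \sum_(x | late_hit U s x) run_step R e s x <= #|U|%:R * (eps / n%:R).
Proof.
have c0 : 0 <= eps / n%:R by rewrite divr_ge0 // eps_ge0.
rewrite /late_hit.
have [sp|sp] := boolP (sparse R e r (high M s)); last first.
  by rewrite big_pred0 // mulr_ge0.
apply: (sum_step_law_on (Q := fun v => M <= seq_load s v)%N) => // v vU Mv.
exact: (step_law_high l simple_e regular_e d_ge3 r_gt0 sp).
Qed.

Lemma sum_div_n (c : R) : \sum_(t < n) c / n%:R = c.
Proof.
rewrite sumr_const card_ord -[_ *+ _]mulr_natr mulfVK //.
by rewrite pnatr_eq0 -lt0n n_gt0.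
Qed.

Lemma run_step_ge0 (s : seq T) x : 0 <= run_step R e s x :> R.
Proof. exact: step_law_ge0. Qed.

Lemma sum_run_step (s : seq T) : \sum_x run_step R e s x = 1 :> R.
Proof. exact: (sum_step_law R r l regular_e d_ge3 _ n_gt0). Qed.

Lemma step_inhabited : exists x : T, True.
Proof.
have /card_gt0P[v _] := n_gt0.
by exists ([tuple of nseq (l * r).+1 v], v).
Qed.

(** Rounding up keeps twice this number at least [reach_count], while staying strictly below it
    still means at most half. *)
Definition half_reach p w : nat := uphalf (reach_count e d r p w).

(** About [N / 16] hits are expected at most, and [N / 2] are required. With [z = 2] and
    [1/2 <= expR (- 1/2)] the exponent is [- N/4 + N/8], and [N] is at least [d.-1 ^ r]. *)
Lemma phase_hits_tail i p w :
  \sum_(om : run V r l | (half_reach p w <= hits (phase_hit i (reach R e r p w)) om)%N)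
    run_law R e om <= expR (- ((d.-1 ^ r)%:R / 8)).
Proof.
have [x0 _] := step_inhabited.
under eq_bigr => om _ do rewrite run_law_kernel.
set N := reach_count e d r p w; set S := reach R e r p w.
have SN : (#|S| <= N)%N by exact: (card_reach R simple_e regular_e d_ge3 r_gt0).
have N0 : (0 < N)%N by exact: (reach_count_gt0 regular_e d_ge3 r_gt0).
apply: le_trans (hits_tail (z := 2) (p := fun t =>
    #|S|%:R * (32 * (phase t == i.+1)%:R + eps) / n%:R) (half_reach p w) x0 _
    run_step_ge0 sum_run_step _) _.
- by rewrite ler1n.
- by move=> s _; exact: phase_hit_prob.
have sump : \sum_(t < n) #|S|%:R * (32 * (phase t == i.+1)%:R + eps) / n%:R
    <= N%:R / 16 :> R.
  rewrite (eq_bigr (fun t : 'I_n => #|S|%:R * (32 / n%:R) * (phase t == i.+1)%:R +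
     (#|S|%:R * eps) / n%:R)); last by move=> t _; ring.
  rewrite big_split /= sum_div_n -big_distrr /= -natr_sum.
  (* As [M <= n], the extra ball per phase at most doubles [n %/ M]; the factor 2 in [M_large]
     absorbs this. *)
  have ph : (\sum_(t < n) (phase t == i.+1))%:R <= n%:R / 32 ^+ 2 :> R.
    apply: (@le_trans _ _ phase_len%:R); first by rewrite ler_nat sum_phase.
    have q1 : 1 <= (n %/ M)%:R :> R by rewrite ler1n divn_gt0 // M_gt0.
    have qn : (n %/ M)%:R * M%:R <= n%:R :> R by rewrite -natrM ler_nat leq_trunc_div.
    rewrite /phase_len -natr1; apply: (@le_trans _ _ (2 * (n %/ M)%:R)); first by lra.
    rewrite ler_pdivlMr ?exprn_gt0 //; apply: le_trans qn.
    by rewrite [leLHS]mulrAC mulrC ler_wpM2l.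
  have n0 : 0 < n%:R :> R by rewrite ltr0n n_gt0.
  have b1 : 32 / n%:R * (\sum_(t < n) (phase t == i.+1))%:R <= 32^-1 :> R.
    rewrite mulrAC ler_pdivrMr //; apply: le_trans (ler_wpM2l _ ph) _ => //.
    by rewrite [leLHS](_ : _ = 32^-1 * n%:R) //; field.
  have SNr : #|S|%:R <= N%:R :> R by rewrite ler_nat.
  apply: (@le_trans _ _ (#|S|%:R * 16^-1)); last by rewrite ler_wpM2r // invr_ge0.
  rewrite -mulrA -mulrDr; apply: ler_wpM2l; first by rewrite ler0n.
  by have := eps_small; lra.
apply: (@le_trans _ _ (expR (- (half_reach p w)%:R / 2) * expR (2 * (N%:R / 16)))).
  apply: ler_pM; rewrite ?invr_ge0 ?exprn_ge0 ?expR_ge0 //.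
    rewrite -exprVn mulrC mulrN -mulNr expRM_natr.
    apply: lerXn2r; rewrite ?nnegrE ?expR_ge0 ?invr_ge0 //.
    by have := expR_ge1Dx (- 2^-1 : R); lra.
  by rewrite ler_expR ler_pM2l.
rewrite -expRD ler_expR.
have : (N <= 2 * half_reach p w)%N.
  by rewrite /half_reach -/N uphalf_half; have := odd_double_half N; lia.
have : (d.-1 ^ r <= N)%N by exact: (reach_count_ge regular_e r_gt0).
rewrite -(ler_nat R) -[X in _ -> is_true X -> _](ler_nat R) natrM; lra.
Qed.

(** The expected number of hits is at most [l.+1 * eps], so [z = eps^-1] leaves only the factor
    [expR l.+1]. *)
Lemma late_hits_tail h (u : walk V r l) : nb_walk e u ->
  \sum_(om : run V r l | (h * l.+1 <= hits (late_hit (choices u)) om)%N)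
    run_law R e om <= eps ^+ (h * l.+1) * expR l.+1%:R.
Proof.
move=> nbu; have [x0 _] := step_inhabited.
under eq_bigr => om _ do rewrite run_law_kernel.
have cu : #|choices u| = l.+1.
  apply: (card_choices r_gt0 x0.2); apply: (nb_walk_uniq simple_e girth_lr nbu).
  by rewrite size_tuple.
have e0 := eps_gt0; have ene : eps != 0 by rewrite gt_eqF.
apply: le_trans (hits_tail (z := eps^-1) (p := fun t =>
    l.+1%:R * (eps / n%:R)) (h * l.+1) x0 _ run_step_ge0 sum_run_step _) _.
- by rewrite invf_ge1 //; have := eps_small; lra.
- by move=> s _; have := late_hit_prob (choices u) s; rewrite cu.
rewrite -exprVn invrK ler_wpM2l ?exprn_ge0 ?eps_ge0 // ler_expR.
rewrite (eq_bigr (fun t : 'I_n => (l.+1%:R * eps) / n%:R)); last by move=> t _; ring.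
by rewrite sum_div_n mulrCA mulVf // mulr1.
Qed.

Definition calm (om : run V r l) : Prop := forall i p w, (i < M)%N ->
  (hits (phase_hit i (reach R e r p w)) om < half_reach p w)%N.

(* Strong induction on time: as long as the sets of heavily loaded bins have
   been sparse, each bin that has become heavy is accounted for by a hit. *)
Lemma calm_sparse om (t : nat) : calm om -> (t < n)%N ->
  sparse R e r (high (phase t) (take t (hist om))).
Proof.
move=> co; have [m] := ubnP t; elim: m t => // m IH t tm tn.
have szt s : (s < n)%N -> size (take s (hist om)) = s.
  by move=> sn; rewrite size_takel // size_hist ltnW.
apply/forallP => p; apply/forallP => w.
apply: le_trans (escape_reach R simple_e regular_e d_ge3 r_gt0 girth_2r p w _) _.
set S := reach R e r p w; set N := reach_count e d r p w.
have N0 : (0 < N)%N by exact: (reach_count_gt0 regular_e d_ge3 r_gt0).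
have iM : (t %/ phase_len < M)%N by exact: phase_le.
set i := (t %/ phase_len)%N in iM *.
have := co i p w iM; rewrite -/S /half_reach -/N => hlt.
suff : (#|high (phase t) (take t (hist om)) :&: S| <=
        hits (phase_hit i S) om)%N.
  move=> le1; rewrite ler_pdivrMr ?ltr0n //.
  have : (#|high (phase t) (take t (hist om)) :&: S| * 2 <= N)%N.
    by move: hlt; rewrite uphalf_half; have := odd_double_half N; lia.
  rewrite -(ler_nat R) natrM; lra.
rewrite /hits.
apply: leq_trans (leq_imset_card (fun s : 'I_n => (om s).2) _).
apply: subset_leq_card; apply/fintype.subsetP => v; rewrite !inE => /andP[vh vS].
have [s [st sv si]] := seq_load_cross (ltnW tn) vh.
apply/imsetP; exists s => //; rewrite inE /phase_hit szt // sv vS si eqxx.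
rewrite leq_phase ?(ltnW st) //= andbT.
by apply: IH; [exact: leq_trans st _|exact: ltn_trans st tn].
Qed.

Lemma calm_sparse_late om (t : nat) : calm om -> (t < n)%N ->
  sparse R e r (high M (take t (hist om))).
Proof.
move=> co tn; apply: sparseS (calm_sparse co tn).
apply/fintype.subsetP => v; rewrite !inE; exact/leq_trans/phase_le.
Qed.

(** Each choice has crossed the [h] levels from [M] on, and the bin and level of a crossing are
    determined by its time, so there are at least as many hits as pairs. *)
Lemma late_hits_ge h om (t : 'I_n) : calm om ->
  (forall v, v \in choices (om t).1 -> (M + h <= seq_load (take t (hist om)) v)%N) ->
  (h * #|choices (om t).1| <= hits (late_hit (choices (om t).1)) om)%N.
Proof.
move=> co; set U := choices _ => Uh.
have -> : (h * #|U|)%N = #|finset.setX U [set: 'I_h]%SET|.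
  by rewrite cardsX cardsT card_ord mulnC.
(* The type ['I_h.+1] is inhabited even for [h = 0], as [inord] requires; [g] embeds the actual
   pairs into it. *)
pose f (s : 'I_n) : V * 'I_h.+1 :=
  ((om s).2, inord (seq_load (take s (hist om)) (om s).2 - M)).
pose g (x : V * 'I_h) : V * 'I_h.+1 := (x.1, widen_ord (leqnSn h) x.2).
have gi : injective g.
  by move=> [x i] [y j] [-> ij]; congr (_, _); apply: val_inj.
rewrite -(card_imset _ gi).
apply: leq_trans (leq_imset_card f _).
apply: subset_leq_card; apply/fintype.subsetP => _ /imsetP[[v i] + ->].
rewrite !inE /= andbT => vU.
have [|s [st sv si]] := @seq_load_cross _ _ _ om t (M + i) v (ltnW (ltn_ord t)).
  by apply: leq_trans (Uh v vU); rewrite ltn_add2l.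
apply/imsetP; exists s.
  rewrite inE /late_hit calm_sparse_late //= sv vU si leq_addr //.
rewrite /f /g sv si addKn /=; congr (_, _); apply: val_inj => /=.
by rewrite inordK // ltnW // ltnS.
Qed.

(** Take the ball that lifts a bin from load [M + h]: all its choices have at least this load, so
    [late_hits_ge] contradicts the bound on late hits. Positive probability ensures that its walk is
    non-backtracking and its bin a least loaded choice. *)
Lemma max_load_calm h (om : run V r l) : 0 < run_law R e om -> calm om ->
  (forall u : walk V r l, nb_walk e u ->
     (hits (late_hit (choices u)) om < h * l.+1)%N) ->
  (max_load om <= M + h)%N.
Proof.
move=> om0 co late; rewrite /max_load; apply/bigmax_leqP => v _.
rewrite load_hist // leqNgt; apply/negP => vh.
have [t [_ tv tl]] := seq_load_cross (leqnn n) vh.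
have : run_step R e (take t (hist om)) (om t) != 0.
  apply: contraTneq om0 => t0; rewrite run_law_kernel /run_kernel (bigD1 t) //=.
  by rewrite t0 mul0r ltxx.
rewrite /run_step /step_law mulf_eq0 negb_or => /andP[lu].
rewrite /unif mulf_eq0 negb_or => /andP[+ _].
rewrite pnatr_eq0 eqb0 negbK inE => /andP[vu /forallP vmin].
have nbu : nb_walk e (om t).1.
  apply: (@walk_law_gt0 R _ _ d) => //.
  by rewrite lt_def walk_law_ge0 -law_tuple lu.
have := late _ nbu; rewrite ltnNge => /negP; apply.
rewrite -(@card_choices V r l r_gt0 v (om t).1); last first.
  by apply: (nb_walk_uniq simple_e girth_lr nbu); rewrite size_tuple.
apply: late_hits_ge => // x xu; rewrite -tl -tv.
by have /implyP := vmin x; apply.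
Qed.

(** Every such walk has mass at least [1 / (n d^(l r))], and the masses sum to 1. *)
Lemma card_nb_walk :
  (#|[set u : walk V r l | nb_walk e u]%SET| <= n * d ^ (l * r))%N.
Proof.
have := sum_walk_law R regular_e d_ge3 (l * r) n_gt0.
have lr0 : (0 < l * r)%N by rewrite muln_gt0 l_gt0.
have D0 : 0 < (n * d ^ (l * r))%:R :> R.
  by rewrite ltr0n muln_gt0 n_gt0 expn_gt0; apply/orP; left; lia.
rewrite -(ler_nat R) => s1.
rewrite -[leRHS]mul1r -ler_pdivrMr //; rewrite -[leRHS]s1.
rewrite -sum1_card natr_sum big_distrl /=.
rewrite [leLHS]big_mkcond; apply: ler_sum => u _; rewrite inE.
case: ifP => [nbu|_]; last exact: walk_law_ge0.
have := size_tuple u; case: (tval u) nbu => [|x [|y s]] //= nbu.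
  by move=> [lr]; rewrite -lr in lr0.
move=> [sz]; rewrite -/(walk_law R e [:: x, y & s]).
rewrite (walk_law_cons2 R simple_e regular_e).
rewrite -/(nb_walk e [:: x, y & s]) /= in nbu; rewrite [nb_walk _ _]nbu.
have d0 : (0 < d)%N by lia.
have dp0 : (0 < d.-1)%N by lia.
rewrite !mul1r lef_pV2 ?posrE // ?ltr0n ?muln_gt0 ?n_gt0 ?expn_gt0 ?d0 ?dp0 //.
rewrite ler_nat -sz expnS; apply: leq_mul => //; apply: leq_mul => //.
by case: (size s) => // k; rewrite leq_exp2r // leq_pred.
Qed.

Lemma sum_run_law : \sum_(om : run V r l) run_law R e om = 1 :> R.
Proof.
have [x0 _] := step_inhabited; rewrite -[RHS](sum_run_kernel1 n x0 sum_run_step).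
by apply: eq_bigr => om _; rewrite run_law_kernel.
Qed.

Lemma run_law_ge0 (om : run V r l) : 0 <= run_law R e om :> R.
Proof. by rewrite run_law_kernel; apply: prodr_ge0 => t _; exact: run_step_ge0. Qed.

Lemma Pr_run_le (A B : pred (run V r l)) :
  (forall om, 0 < run_law R e om -> A om -> B om) -> Pr_run R e A <= Pr_run R e B.
Proof.
move=> AB; rewrite /Pr_run [leLHS]big_mkcond [leRHS]big_mkcond.
apply: ler_sum => om _; have := run_law_ge0 om; rewrite le_eqVlt => /orP[/eqP <-|o0].
  by rewrite !if_same.
case: ifP => [/(AB _ o0) ->|_] //; case: ifP => // _; exact: ltW.
Qed.

Lemma Pr_run_exists (I : finType) (P : pred I) (A : I -> pred (run V r l)) :
  Pr_run R e (fun om => [exists i, P i && A i om]) <= \sum_(i | P i) Pr_run R e (A i).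
Proof.
rewrite /Pr_run (eq_bigr (fun i => \sum_om (if A i om then run_law R e om else 0)));
  last by move=> i _; rewrite big_mkcond.
rewrite exchange_big /= [leLHS]big_mkcond; apply: ler_sum => om _.
have s0 : 0 <= \sum_(i | P i) (if A i om then run_law R e om else 0).
  by apply: sumr_ge0 => i _; case: ifP => // _; exact: run_law_ge0.
case: existsP => [[i /andP[Pi Ai]]|_] //.
rewrite (bigD1 i) //= Ai lerDl; apply: sumr_ge0 => j _.
by case: ifP => // _; exact: run_law_ge0.
Qed.

(** Union bound over the triples [(i, p, w)], where [p] has [n.+1] values, and over the
    non-backtracking walks. *)
Theorem max_load_tail h :
  1 - ((M * (n.+1 * n))%:R * expR (- ((d.-1 ^ r)%:R / 8)) +
       (n * d ^ (l * r))%:R * (eps ^+ (h * l.+1) * expR l.+1%:R)) <=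
  Pr_run R e (fun om : run V r l => max_load om <= M + h)%N.
Proof.
pose A := fun om : run V r l => (max_load om <= M + h)%N.
pose B1 (x : 'I_M * (option V * V)) := fun om : run V r l =>
  (half_reach x.2.1 x.2.2 <= hits (phase_hit x.1 (reach R e r x.2.1 x.2.2)) om)%N.
pose B2 (u : walk V r l) := fun om : run V r l =>
  (h * l.+1 <= hits (late_hit (choices u)) om)%N.
pose E1 := fun om => [exists x, true && B1 x om].
pose E2 := fun om => [exists u, nb_walk e (tval u) && B2 u om].
have AC : Pr_run R e (fun om => ~~ A om) <= Pr_run R e (fun om => E1 om || E2 om).
  apply: Pr_run_le => om om0; apply: contraNT.
  rewrite negb_or => /andP[/existsPn nE1 /existsPn nE2]; apply: max_load_calm => //.
    move=> i p w iM; have := nE1 (Ordinal iM, (p, w)).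
    by rewrite /B1 /= -ltnNge.
  by move=> u nbu; have := nE2 u; rewrite nbu /B2 /= -ltnNge.
have E12 : Pr_run R e (fun om => E1 om || E2 om) <= Pr_run R e E1 + Pr_run R e E2.
  rewrite /Pr_run [leLHS]big_mkcond [X in _ <= X + _]big_mkcond.
  rewrite [X in _ <= _ + X]big_mkcond -big_split /=; apply: ler_sum => om _.
  have := run_law_ge0 om.
  by case: (E1 om) => /=; case: (E2 om) => /=; lra.
have P1 : Pr_run R e E1 <= (M * (n.+1 * n))%:R * expR (- ((d.-1 ^ r)%:R / 8)).
  apply: le_trans (Pr_run_exists _ _) _.
  apply: (@le_trans _ _ (\sum_(x : 'I_M * (option V * V))
     expR (- ((d.-1 ^ r)%:R / 8)))).
    by apply: ler_sum => -[i [p w]] _; exact: phase_hits_tail.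
  by rewrite sumr_const !card_prod card_ord card_option -[_ *+ _]mulr_natl.
have P2 : Pr_run R e E2 <=
    (n * d ^ (l * r))%:R * (eps ^+ (h * l.+1) * expR l.+1%:R).
  apply: le_trans (Pr_run_exists (fun u : walk V r l => nb_walk e u) _) _.
  apply: (@le_trans _ _ (\sum_(u : walk V r l | nb_walk e u)
     eps ^+ (h * l.+1) * expR l.+1%:R)).
    by apply: ler_sum => u nbu; exact: late_hits_tail.
  rewrite sumr_const -[_ *+ _]mulr_natl; apply: ler_wpM2r.
    by rewrite mulr_ge0 ?exprn_ge0 ?eps_ge0 ?expR_ge0.
  rewrite ler_nat; apply: leq_trans card_nb_walk.
  by apply/eq_leq/eq_card => u; rewrite !inE.
have tot : Pr_run R e A + Pr_run R e (fun om => ~~ A om) = 1.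
  by rewrite -sum_run_law /Pr_run [RHS](bigID A).
by move: AC E12 P1 P2 tot; rewrite -/A; lra.
Qed.

End FiniteBound.

(** * Estimates for a single graph *)

Section Numerics.
Variable R : realType.

Lemma rG_bounds (n d : nat) : 0 < logb (d%:R - 1) (ln n%:R) :> R ->
  2 * logb (d%:R - 1) (ln n%:R) <= (rG R n d)%:R :> R /\
  (rG R n d)%:R <= 2 * logb (d%:R - 1) (ln n%:R) + 1 :> R.
Proof.
rewrite /rG; set x := 2 * _ => x0'.
have x0 : 0 < x by rewrite mulr_gt0.
have c0 : (0 <= Num.ceil x)%R by rewrite ceil_ge0; lra.
have -> : `|Num.ceil x|%N%:R = (Num.ceil x)%:~R :> R.
  by rewrite -[in RHS](gez0_abs c0).
have /andP[A B] := ceil_itv x; split=> //;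
  move: A; rewrite intrB; lra.
Qed.

Lemma ln2_ge : 2^-1 <= ln 2 :> R.
Proof.
rewrite -ler_expR lnK ?posrE //.
by have := expR_ge1Dx (- 2^-1 : R); rewrite expRN; set y := expR _ => H;
   have y0 : 0 < y by [exact: expR_gt0]; rewrite -lef_pV2 ?posrE //; lra.
Qed.

Lemma eps_bound (l : nat) : 64 ^+ 2 <= l%:R :> R ->
  l.+1%:R * (3 / 4) ^+ l./2 <= expR (- (l%:R / 16)) :> R /\
  l.+1%:R * (3 / 4) ^+ l./2 <= 32^-1 :> R.
Proof.
move=> l0.
have e1 : (3 / 4) ^+ l./2 <= expR (8^-1 - l%:R / 8) :> R.
  apply: (@le_trans _ _ (expR (- 4^-1) ^+ l./2)).
    apply: lerXn2r; rewrite ?nnegrE ?expR_ge0 //.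
    by have := expR_ge1Dx (- 4^-1 : R); lra.
  rewrite -expRM_natr ler_expR.
  have : (l <= 2 * l./2 + 1)%N by have := odd_double_half l; lia.
  by rewrite -(ler_nat R) natrD natrM; lra.
(* One of the two factors [expR (- l / 16)] pays for [l.+1] and the constant; [l >= 64^2] gives
   [2 (l + 1) <= (1 + l/32)^2]. *)
have e2 : 2 * l.+1%:R <= expR (l%:R / 16) :> R.
  rewrite (_ : l%:R / 16 = l%:R / 32 * 2%:R); last by field.
  rewrite expRM_natr; apply: (@le_trans _ _ ((1 + l%:R / 32) ^+ 2)).
    by rewrite -natr1 expr2; nra.
  by apply: lerXn2r; rewrite ?nnegrE ?expR_ge0 ?expR_ge1Dx // addr_ge0 // divr_ge0.
have e3 : expR 8^-1 <= 2 :> R.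
  have := expR_ge1Dx (- 8^-1 : R); rewrite expRN; set y := expR _ => H.
  have y0 : 0 < y by exact: expR_gt0.
  by rewrite -lef_pV2 ?posrE //; lra.
have e4 : l.+1%:R * (3 / 4) ^+ l./2 <= expR (- (l%:R / 16)) :> R.
  apply: (@le_trans _ _ (l.+1%:R * expR (8^-1 - l%:R / 8))).
    by apply: ler_wpM2l.
  rewrite (_ : 8^-1 - l%:R / 8 = 8^-1 + - (l%:R / 16) + - (l%:R / 16)); last by field.
  rewrite !expRD mulrA; rewrite -[leRHS]mul1r; apply: ler_wpM2r; first exact: expR_ge0.
  rewrite expRN mulrA ler_pdivrMr ?expR_gt0 // mul1r; apply: le_trans e2.
  by rewrite [leRHS]mulrC; apply: ler_wpM2l.
split=> //; apply: le_trans e4 _; rewrite expRN lef_pV2 ?posrE ?expR_gt0 //.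
by apply: le_trans e2; rewrite -natr1; lra.
Qed.

Lemma girth_cycle (V : finType) (e : rel V) (x : R) c :
  (x%:E <= girth R e)%E -> graph_cycle e c -> x <= (size c)%:R.
Proof.
move=> xg gc; rewrite -lee_fin; apply: le_trans xg _.
by apply: ereal_inf_lbound; exists c.
Qed.

End Numerics.

(** * From numerical conditions on one graph to the tail bound *)

Section Pointwise.
Variables (R : realType) (V : finType) (e : rel V) (d l M : nat).
Hypotheses (simple_e : simple_graph e) (regular_e : regular e d).
Hypothesis d_ge3 : (3 <= d)%N.
Hypothesis M_large : 2 * 32 ^+ 2 <= M%:R :> R.
Notation n := #|V|.
Let r := rG R n d.
Let L : R := ln n%:R.
Let LL : R := loglog R n.
Hypothesis n_large : 4 * M%:R <= n%:R :> R.
Hypothesis L_large : 32 <= L.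
Hypothesis LL_large : 16 <= LL.
Hypothesis d_small : ln d%:R <= 2 * LL.
Hypothesis l_large : 64 ^+ 2 <= l%:R :> R.
Hypothesis girth_e : ((10 * l%:R * LL ^+ 2)%:E <= girth R e)%E.

Lemma lnd1_ge : 2^-1 <= ln (d%:R - 1) :> R.
Proof.
apply: le_trans (ln2_ge R) _; rewrite ler_ln ?posrE //.
  by have : 3 <= d%:R :> R by [rewrite ler_nat]; lra.
by have : 3 <= d%:R :> R by [rewrite ler_nat]; lra.
Qed.

Lemma lnd_le : ln d%:R <= 2 * ln (d%:R - 1) :> R.
Proof.
have d3 : 3 <= d%:R :> R by rewrite ler_nat.
rewrite mulr_natl -lnXn ?subr_gt0; last by lra.
by rewrite ler_ln ?posrE ?exprn_gt0; try lra; rewrite expr2; nra.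
Qed.

Lemma lnd_ge : 2^-1 <= ln d%:R :> R.
Proof.
have d3 : 3 <= d%:R :> R by rewrite ler_nat.
by apply: le_trans lnd1_ge _; rewrite ler_ln ?posrE; lra.
Qed.

Lemma r_bounds : 2 * LL <= r%:R * ln (d%:R - 1) /\
  r%:R * ln (d%:R - 1) <= 2 * LL + ln (d%:R - 1).
Proof.
have d1 := lnd1_ge; have dp : 0 < ln (d%:R - 1) :> R by lra.
have lb0 : 0 < logb (d%:R - 1) (ln n%:R) :> R.
  by apply: divr_gt0 dp; apply: lt_le_trans LL_large.
have [A B] := rG_bounds lb0; move: A B; rewrite -/r /logb -/(loglog R n) -/LL.
rewrite mulrA ler_pdivrMr // => A B; split=> //.
apply: le_trans (ler_wpM2r (ltW dp) B) _.
by rewrite mulrDl mulfVK ?mul1r // gt_eqF.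
Qed.

Lemma r_gt0 : 0 < r%:R :> R.
Proof.
have [A _] := r_bounds; have d1 := lnd1_ge.
rewrite ltr0n lt0n; apply/eqP => r0; move: A; rewrite r0 mul0r.
by have := LL_large; lra.
Qed.

Lemma r_le : r%:R <= 5 * LL.
Proof.
have [_ B] := r_bounds; have d1 := lnd1_ge.
rewrite -(ler_pM2r (_ : 0 < ln (d%:R - 1))); last by lra.
apply: le_trans B _; have := LL_large; nra.
Qed.

Lemma rlnd_le : r%:R * ln d%:R <= 8 * LL.
Proof.
have [_ B] := r_bounds; have d1 := lnd1_ge; have d2 := lnd_le; have r0 := r_gt0.
have rp : r%:R * ln d%:R <= r%:R * (2 * ln (d%:R - 1)) :> R.
  by rewrite ler_pM2l.
have d4 : ln (d%:R - 1) <= ln d%:R :> R.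
  have d3 : 3 <= d%:R :> R by rewrite ler_nat.
  by rewrite ler_ln ?posrE; lra.
by move: rp B; have := d_small; lra.
Qed.

(** This is what the choice of [rG] is for: the exponent in [phase_hits_tail] becomes of order
    [(ln n)^2]. *)
Lemma pow_r_ge : L ^+ 2 <= (d.-1 ^ r)%:R.
Proof.
have [A _] := r_bounds.
have d3 : 3 <= d%:R :> R by rewrite ler_nat.
have dE : d.-1%:R = d%:R - 1 :> R by rewrite -subn1 natrB // (leq_trans _ d_ge3).
have L0 : 0 < L by have := L_large; lra.
rewrite natrX dE -[X in X ^+ r](@lnK _ (d%:R - 1)) ?posrE; last by lra.
rewrite -[X in X ^+ 2](@lnK _ L) ?posrE // -!expRM_natr ler_expR.
by rewrite mulrC [leRHS]mulrC.
Qed.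

Lemma size_cycle_gt c : graph_cycle e c -> (2 * r < size c)%N /\ (l * r < size c)%N.
Proof.
move=> /(girth_cycle girth_e) gc; have r5 := r_le; have LL0 := LL_large.
have l0 := l_large; have rp := r_gt0.
have lL : l%:R * r%:R <= l%:R * (5 * LL) by rewrite ler_pM2l //; lra.
have LL1 : 16 * LL <= LL ^+ 2 by rewrite expr2 ler_pM2r //; lra.
have lLL : l%:R * (16 * LL) <= l%:R * LL ^+ 2 by rewrite ler_pM2l //; lra.
have lL0 : 64 ^+ 2 * LL <= l%:R * LL by rewrite ler_pM2r //; lra.
by split; rewrite -(ltr_nat R) natrM; apply: lt_le_trans gc; lra.
Qed.

Lemma n_real : n%:R = expR L :> R.
Proof. by rewrite lnK // posrE; have := n_large; have := M_large; lra. Qed.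

(** Since [L >= 32], the exponent [L^2 / 8] is at least [4 L], so the exponential is at most [n^-4],
    against a prefactor of at most [2 M n^2 <= n^3 / 2]. *)
Lemma tail_phases :
  (M * (n.+1 * n))%:R * expR (- ((d.-1 ^ r)%:R / 8)) <= 2^-1 * n%:R^-1 :> R.
Proof.
have L0 := L_large; have M0 := M_large; have nM := n_large.
have n0 : 0 < n%:R :> R by lra.
have P := pow_r_ge.
apply: (@le_trans _ _ (M%:R * (2 * n%:R * n%:R) * expR (- (4 * L)))).
  apply: ler_pM; rewrite ?expR_ge0 ?ler0n //.
    have M0' : 0 <= M%:R :> R by rewrite ler0n.
    have n1 : n.+1%:R <= 2 * n%:R :> R.
      by rewrite -natr1 mulr_natl mulr2n lerD2l ler1n -(ltr0n R).
    rewrite !natrM.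
    apply: ler_wpM2l => //.
    exact: ler_wpM2r.
  have L32 : 32 * L <= L ^+ 2 by rewrite expr2 ler_pM2r //; apply: lt_le_trans L0.
  rewrite ler_expR; move: P L32; generalize (d.-1 ^ r)%N => D P L32.
  by move: (le_trans L32 P); lra.
rewrite expRN mulrC (_ : 4 * L = L * 4%:R); last by ring.
rewrite expRM_natr -n_real.
have -> : 2^-1 * n%:R^-1 = (n%:R ^+ 4)^-1 * (2^-1 * n%:R ^+ 3) :> R.
  by field; rewrite gt_eqF.
apply: ler_wpM2l; first by rewrite invr_ge0 exprn_ge0 // ltW.
have -> : M%:R * (2 * n%:R * n%:R) = 2^-1 * (4 * M%:R * n%:R ^+ 2) :> R by field.
have -> : n%:R ^+ 3 = n%:R * n%:R ^+ 2 :> R by ring.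
apply: ler_wpM2l; first by rewrite invr_ge0.
by apply: ler_wpM2r => //; rewrite exprn_ge0 // ltW.
Qed.

(** The exponent [l^2 h / 16] has to beat [2 L + 8 l LL + l + 2]: a third of it is at least [2 L] by
    the first hypothesis, the rest at least [13 l LL] by the second. *)
Lemma tail_late (h : nat) :
  96 * L <= l%:R ^+ 2 * h%:R -> 320 * LL <= l%:R * h%:R ->
  (n * d ^ (l * r))%:R *
    ((l.+1%:R * (3 / 4) ^+ l./2) ^+ (h * l.+1) * expR l.+1%:R) <= 2^-1 * n%:R^-1 :> R.
Proof.
move=> hL hLL; have L0 := L_large; have LL0 := LL_large; have l0 := l_large.
have [e1 _] := eps_bound l_large.
have d3 : 3 <= d%:R :> R by rewrite ler_nat.
have rl := rlnd_le; have rp := r_gt0.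
apply: (@le_trans _ _ (expR (L + l%:R * r%:R * ln d%:R +
   (- (l%:R / 16) * (h%:R * l.+1%:R) + l.+1%:R)))).
  rewrite !expRD natrM natrX -n_real; apply: ler_pM; rewrite ?mulr_ge0 ?exprn_ge0 ?expR_ge0 //.
    apply: ler_wpM2l => //.
    by rewrite mulrC -natrM expRM_natr lnK // posrE; lra.
  apply: ler_wpM2r; first exact: expR_ge0.
  rewrite -natrM expRM_natr; apply: lerXn2r; rewrite ?nnegrE ?mulr_ge0 ?exprn_ge0 ?expR_ge0 //.
have -> : 2^-1 * n%:R^-1 = (2 * n%:R)^-1 :> R by rewrite invfM.
have nE := n_real.
apply: (@le_trans _ _ (expR (- (1 + L)))); last first.
  rewrite expRN lef_pV2 ?posrE ?expR_gt0 // ?mulr_gt0 ?nE ?expR_gt0 //.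
  rewrite expRD; apply: ler_wpM2r; first exact: expR_ge0.
  by have := expR_ge1Dx (1 : R); lra.
rewrite ler_expR -[l.+1%:R]natr1.
have h0 : 0 <= h%:R :> R by rewrite ler0n.
have B : l%:R * (320 * LL) <= l%:R * (l%:R * h%:R) by rewrite ler_pM2l //; lra.
have C : l%:R * (r%:R * ln d%:R) <= l%:R * (8 * LL) by rewrite ler_pM2l //; lra.
have lL : l%:R * 16 <= l%:R * LL by rewrite ler_pM2l //; lra.
have lh : 0 <= l%:R * h%:R :> R by rewrite mulr_ge0 // ler0n.
move: hL B; rewrite expr2 => hL B.
by lra.
Qed.

Lemma max_load_whp (f : R) : 1 <= f -> L / 8 <= l%:R ^+ 2 * f -> LL / 16 <= l%:R * f ->
  1 - n%:R `^ (- 1) <= Pr_max_load_le e r l (8 * M%:R * f).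
Proof.
move=> f1 fL fLL; have M0 := M_large; have l0 := l_large; have nM := n_large.
have L0 := L_large; have LL0 := LL_large.
have Mf : M%:R <= M%:R * f by rewrite ler_peMr //; lra.
have /andP[m1 m2] : (Num.truncn (8 * M%:R * f))%:R <= 8 * M%:R * f <
    (Num.truncn (8 * M%:R * f)).+1%:R by apply: truncn_itv; lra.
set m := Num.truncn _ in m1 m2.
rewrite -natr1 in m2.
have Mm : (M <= m)%N by rewrite -(ler_nat R); lra.
have hE : (m - M)%:R = m%:R - M%:R :> R by rewrite natrB.
set h := (m - M)%N in hE.
have hf : 4 * M%:R * f <= h%:R by rewrite hE; lra.
have hf' : (2 * 64 ^+ 2) * f <= h%:R.
  by apply: le_trans hf; apply: ler_wpM2r; lra.
have h1 : 96 * L <= l%:R ^+ 2 * h%:R.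
  have : l%:R ^+ 2 * ((2 * 64 ^+ 2) * f) <= l%:R ^+ 2 * h%:R.
    by apply: ler_wpM2l => //; rewrite exprn_ge0.
  lra.
have h2 : 320 * LL <= l%:R * h%:R.
  have : l%:R * ((2 * 64 ^+ 2) * f) <= l%:R * h%:R by apply: ler_wpM2l.
  lra.
have [_ e32] := eps_bound l_large.
(* The two conditions of [tail_late] now hold: [4 M >= 2 * 64^2] turned [L / 8] and [LL / 16] into
   [1024 L] and [512 LL]. *)
have r0 : (0 < r)%N by rewrite -(ltr0n R) r_gt0.
have l1 : (0 < l)%N by rewrite -(ltr0n R); lra.
have Mn : (M <= n)%N by rewrite -(ler_nat R); lra.
have B := @max_load_tail R V e d r l M simple_e regular_e d_ge3 r0 l1
  (fun c gc => (size_cycle_gt gc).1) (fun c gc => (size_cycle_gt gc).2) M_large Mn e32 h.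
have T1 := tail_phases; have T2 := tail_late h1 h2.
have Pm : Pr_run R e (fun om : run V r l => max_load om <= M + h)%N <=
    Pr_max_load_le e r l (8 * M%:R * f).
  apply: Pr_run_le => om _ omh; apply: le_trans m1.
  by rewrite ler_nat (leq_trans omh) // subnKC.
have nV : n%:R `^ (- 1) = n%:R^-1 :> R by rewrite powR_inv1 // ler0n.
rewrite nV; apply: le_trans Pm; apply: le_trans B.
by move: T1 T2; set a := _ * expR _; set b := _ * (_ * _) => T1 T2; lra.
Qed.

(** The requirements of [tail_late] up to a constant factor; [1 <= f] lets a multiple of [f] absorb
    the level [M]. *)
Definition admissible (f : R) : Prop :=
  [/\ 1 <= f, L / 8 <= l%:R ^+ 2 * f & LL / 16 <= l%:R * f].

(** With [X = log_d n], the hypothesis says [l^2 r <= 16 X], so the bound is at least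
    [LL / 16 >= 1]. Its product with [l^2] is [X LL / r], at least [L / 8] because
    [r ln d <= 8 LL]. *)
Lemma bound_I_admissible : l%:R <= 4 * gammaG' R n d ->
  admissible (bound_I R n d l).
Proof.
have L0 := L_large; have LL0 := LL_large; have l0 := l_large.
have d0 := lnd_ge; have rp := r_gt0; have rl := rlnd_le.
rewrite /gammaG' /bound_I /logb -/r -/L -/LL => lg.
set X := L / ln d%:R in lg *.
have X0 : 0 < X by rewrite divr_gt0 //; lra.
have lp : 0 < l%:R :> R by lra.
have l2 : 0 < l%:R ^+ 2 :> R by rewrite exprn_gt0.
have XL : X * ln d%:R = L by rewrite mulfVK // gt_eqF //; lra.
clearbody X.
have l2X : l%:R ^+ 2 * r%:R <= 16 * X.
  rewrite -ler_pdivlMr //.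
  have -> : 16 * X / r%:R = (4 * Num.sqrt (X / r%:R)) ^+ 2.
    rewrite exprMn sqr_sqrtr; last by rewrite divr_ge0 ?ler0n // ltW.
    by ring.
  by apply: lerXn2r; rewrite ?nnegrE // mulr_ge0 // sqrtr_ge0.
have f16 : LL / 16 <= X * LL / (r%:R * l%:R ^+ 2).
  rewrite ler_pdivlMr ?mulr_gt0 //.
  have : LL * (l%:R ^+ 2 * r%:R) <= LL * (16 * X) by rewrite ler_pM2l //; lra.
  move=> H; rewrite [leLHS](_ : _ = LL * (l%:R ^+ 2 * r%:R) / 16); last by ring.
  rewrite ler_pdivrMr //; apply: le_trans H _.
  by rewrite [leLHS](_ : _ = X * LL * 16) //; ring.
split; first by lra.
  have -> : l%:R ^+ 2 * (X * LL / (r%:R * l%:R ^+ 2)) = X * LL / r%:R.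
    by field; rewrite !gt_eqF.
  rewrite ler_pdivlMr // -XL.
  have : X * (r%:R * ln d%:R) <= X * (8 * LL) by rewrite ler_pM2l.
  by move=> H; lra.
have f0 : 0 <= X * LL / (r%:R * l%:R ^+ 2) by apply: le_trans f16; lra.
have l1 : 1 <= l%:R :> R by lra.
by apply: le_trans f16 _; rewrite ler_peMl.
Qed.

(** For [l <= gammaG] the bound is [LL], and [l^2 r >= 16 X] with [r ln d <= 8 LL] gives
    [l^2 LL >= 2 L]. Beyond, write [l = g x] with [g^2 = X]; then [ln x <= x] yields
    [l^2 LL / ln x >= X LL >= L / 2]. *)
Lemma bound_II_admissible : 4 * gammaG' R n d <= l%:R ->
  l%:R <= logb d%:R n%:R :> R -> admissible (bound_II R n d l).
Proof.
have L0 := L_large; have LL0 := LL_large; have l0 := l_large.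
have d0 := lnd_ge; have rp := r_gt0; have rl := rlnd_le; have ds := d_small.
rewrite /gammaG' /bound_II /gammaG /logb -/r -/L -/LL => lg lX.
set X := L / ln d%:R in lg lX *.
have X0 : 0 < X by lra.
have lp : 0 < l%:R :> R by lra.
have XL : X * ln d%:R = L by rewrite mulfVK // gt_eqF //; lra.
clearbody X.
have l2X : 16 * X <= l%:R ^+ 2 * r%:R.
  rewrite -ler_pdivrMr //.
  have -> : 16 * X / r%:R = (4 * Num.sqrt (X / r%:R)) ^+ 2.
    rewrite exprMn sqr_sqrtr; last by rewrite divr_ge0 ?ler0n // ltW.
    by ring.
  by apply: lerXn2r; rewrite ?nnegrE // ?mulr_ge0 ?sqrtr_ge0.
have lLL : LL <= l%:R * LL by rewrite ler_peMl //; lra.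
case: ifP => [gl|_]; last first.
  split; [by lra| |by lra].
  have H1 : 16 * X * ln d%:R <= l%:R ^+ 2 * r%:R * ln d%:R.
    by apply: ler_wpM2r; lra.
  have H2 : l%:R ^+ 2 * (r%:R * ln d%:R) <= l%:R ^+ 2 * (8 * LL).
    by rewrite ler_pM2l // exprn_gt0.
  by move: H1 H2; rewrite -[16 * X * _]mulrA XL; lra.
set g := Num.sqrt X in gl *.
have g2 : g ^+ 2 = X by rewrite sqr_sqrtr // ltW.
have g1 : 1 <= g by rewrite -(@ler_pXn2r _ 2) ?nnegrE ?sqrtr_ge0 // expr1n g2; lra.
have gp : 0 < g by lra.
set x := l%:R / g.
have x1 : 1 < x by rewrite ltr_pdivlMr // mul1r.
have lx : l%:R = g * x by rewrite mulrC mulfVK // gt_eqF.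
have lnx0 : 0 < ln x by rewrite ln_gt0.
have lnxx : ln x <= x.
  have : ln (1 + (x - 1)) <= x - 1 by apply: le_ln1Dx; lra.
  by rewrite addrCA subrr addr0; lra.
have XleL : X <= 2 * L.
  have : X * 2^-1 <= X * ln d%:R by rewrite ler_pM2l.
  by rewrite XL; lra.
(* The upper bound on [l] enters here: [x^2 <= X <= 2 L <= L^2], hence [ln x <= LL] and the bound is
   at least 1. *)
have xg : x <= g by rewrite ler_pdivrMr // -expr2 g2.
clearbody x; clearbody g.
have xL : x <= L.
  rewrite -(@ler_pXn2r _ 2) ?nnegrE //; [|by lra|by lra].
  apply: (@le_trans _ _ (g ^+ 2)); first by apply: lerXn2r; rewrite ?nnegrE //; lra.
  by rewrite g2; apply: le_trans XleL _; rewrite expr2 ler_pM2r; lra.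
have xp : 0 < x by lra.
have Lp : 0 < L by lra.
have lnxLL : ln x <= LL by rewrite ler_ln ?posrE.
have f1 : 1 <= LL / ln x by rewrite ler_pdivlMr // mul1r.
have xl1 : 1 <= x / ln x by rewrite ler_pdivlMr // mul1r.
split=> //.
  have -> : l%:R ^+ 2 * (LL / ln x) = X * LL * (x * (x / ln x)).
    by rewrite lx exprMn g2; ring.
  have : X * LL * 1 <= X * LL * (x * (x / ln x)).
    rewrite ler_pM2l ?mulr_gt0 //; last by lra.
    by apply: le_trans (ler_pM _ _ (ltW x1) xl1); rewrite ?mulr1.
  have : X * ln d%:R <= X * (2 * LL) by rewrite ler_pM2l.
  by rewrite XL; lra.
have -> : l%:R * (LL / ln x) = g * LL * (x / ln x) by rewrite lx; ring.
have : g * LL * 1 <= g * LL * (x / ln x).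
  by rewrite ler_pM2l ?mulr_gt0 //; lra.
have : 1 * LL <= g * LL by rewrite ler_pM2r //; lra.
by lra.
Qed.

End Pointwise.

(** * Asymptotics *)

Section Eventually.
Variables (R : realType) (V : nat -> finType) (e : forall k, rel (V k)).
Arguments e : clear implicits.
Variables (d l : nat -> nat).
Hypothesis simple_e : forall k, simple_graph (e k).
Hypothesis n_infty : (fun k => #|V k|) @ \oo --> \oo.
Hypothesis regular_e : forall k, regular (e k) (d k).
Hypothesis d_ge3 : forall k, (3 <= d k)%N.
Hypothesis d_bigO : (fun k => (d k)%:R : R) =O_\oo (fun k => ln #|V k|%:R : R).
Hypothesis l_infty : l @ \oo --> \oo.
Hypothesis l_littleo : (fun k => (l k)%:R : R) =o_\oo
                 (fun k => logb (d k)%:R #|V k|%:R : R).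
Hypothesis girth_e : forall k,
  ((10 * (l k)%:R * loglog R #|V k| ^+ 2)%:E <= girth R (e k))%E.

Lemma near_natr_ge (u : nat -> nat) (A : R) : u @ \oo --> \oo ->
  \forall k \near \oo, A <= (u k)%:R.
Proof.
move=> /cvgnyPge /(_ (Num.bound `|A|)); apply: filterS => k uk.
apply: le_trans (ler_norm A) _; apply: le_trans (ltW (archi_boundP (normr_ge0 A))) _.
by rewrite ler_nat.
Qed.

Lemma near_ln_ge (A : R) : \forall k \near \oo, A <= ln #|V k|%:R.
Proof.
have := near_natr_ge (expR A) n_infty; apply: filterS => k Ak.
by rewrite -(expRK A) ler_ln ?posrE ?expR_gt0 // (lt_le_trans _ Ak) // expR_gt0.
Qed.

Lemma near_loglog_ge (A : R) : \forall k \near \oo, A <= loglog R #|V k|.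
Proof.
have := near_ln_ge (expR A); apply: filterS => k Ak.
by rewrite -(expRK A) ler_ln ?posrE ?expR_gt0 // (lt_le_trans _ Ak) // expR_gt0.
Qed.

(** From [d <= K ln n], the constant [ln K] is eventually absorbed by a second [loglog]. *)
Lemma near_lnd_le : \forall k \near \oo, ln (d k)%:R <= 2 * loglog R #|V k|.
Proof.
have /eqO_exP[K K0 dK] := d_bigO.
near=> k.
have L1 : 1 <= ln #|V k|%:R :> R by near: k; exact: near_ln_ge.
have LK : ln K <= loglog R #|V k| by near: k; exact: near_loglog_ge.
have : `|(d k)%:R : R| <= K * `|ln #|V k|%:R : R| by near: k.
have L0 : 0 < ln #|V k|%:R :> R by exact: lt_le_trans L1.
rewrite !ger0_norm ?(ltW L0) // => dk.
have dp : 0 < (d k)%:R :> R by rewrite ltr0n (leq_trans _ (d_ge3 k)).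
apply: (@le_trans _ _ (ln (K * ln #|V k|%:R))).
  by rewrite ler_ln ?posrE ?mulr_gt0.
by rewrite lnM ?posrE // -/(loglog R #|V k|); lra.
Unshelve. all: by end_near. Qed.

Lemma near_l_le : \forall k \near \oo, (l k)%:R <= logb (d k)%:R #|V k|%:R :> R.
Proof.
have /eqoP /(_ 1 ltr01) lo := l_littleo.
near=> k.
have L0 : 0 <= ln #|V k|%:R :> R by near: k; exact: near_ln_ge.
have : `|(l k)%:R : R| <= 1 * `|logb (d k)%:R #|V k|%:R : R| by near: k.
rewrite mul1r !ger0_norm //; apply: divr_ge0 => //.
by rewrite ln_ge0 // ler1n (leq_trans _ (d_ge3 k)).
Unshelve. all: by end_near. Qed.

(** The constants do not depend on [k]: [M = 2 * 32^2], [C = 8 M] and [c = 1]. *)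
Lemma whp_admissible (f : nat -> R) :
  (\forall k \near \oo, admissible (V k) (l k) (f k)) ->
  whp_max_load_bigO e d l f.
Proof.
move=> adm.
have [M M_large] : exists M : nat, 2 * 32 ^+ 2 <= M%:R :> R.
  by exists (2 * 32 ^ 2)%N; rewrite natrM natrX.
exists (8 * M%:R), 1; split => //.
  by rewrite mulr_gt0 // (lt_le_trans _ M_large) // mulr_gt0 // exprn_gt0.
near=> k.
have [f1 f2 f3] : admissible (V k) (l k) (f k) by near: k.
apply: max_load_whp f1 f2 f3 => //.
- near: k; exact: near_natr_ge.
- near: k; exact: near_ln_ge.
- near: k; exact: near_loglog_ge.
- near: k; exact: near_lnd_le.
- near: k; exact: near_natr_ge.
Unshelve. all: by end_near. Qed.

End Eventually.

Theorem mainTheorem2 (R : realType) (V : nat -> finType)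
    (e : forall k, rel (V k)) (d l : nat -> nat)
    (simple_e : forall k, simple_graph (e k))
    (n_infty : (fun k => #|V k|) @ \oo --> \oo)
    (regular_e : forall k, regular (e k) (d k))
    (d_ge3 : forall k, (3 <= d k)%N)
    (d_bigO : (fun k => (d k)%:R : R) =O_\oo (fun k => ln #|V k|%:R : R))
    (l_gt0 : forall k, (0 < l k)%N)
    (l_infty : l @ \oo --> \oo)
    (l_littleo : (fun k => (l k)%:R : R) =o_\oo
                 (fun k => logb (d k)%:R #|V k|%:R : R))
    (girth_e : forall k,
       ((10 * (l k)%:R * loglog R #|V k| ^+ 2)%:E <= girth R (e k))%E) :
  ((\forall k \near \oo, (l k)%:R <= 4 * gammaG' R #|V k| (d k)) ->
     whp_max_load_bigO e d l (fun k => bound_I R #|V k| (d k) (l k)))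
  /\
  ((\forall k \near \oo, 4 * gammaG' R #|V k| (d k) <= (l k)%:R) ->
     whp_max_load_bigO e d l (fun k => bound_II R #|V k| (d k) (l k))).
Proof.
split=> lg; apply: whp_admissible => //; near=> k.
  apply: bound_I_admissible => //; near: k => //.
  - exact: near_ln_ge.
  - exact: near_loglog_ge.
  - exact: near_lnd_le.
  - exact: near_natr_ge.
apply: bound_II_admissible => //; near: k => //.
- exact: near_ln_ge.
- exact: near_loglog_ge.
- exact: near_lnd_le.
- exact: near_natr_ge.
- exact: near_l_le.
Unshelve. all: by end_near. Qed.
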